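(* Let $\nu_1,\nu_2>0$ and $\rho\in(-1,1)$, and let $C^{\rho}_{\nu_1,\nu_2}$ be the bivariate $\tilde t_{\mathbf v}$ copula with degrees of freedom $\nu_1,\nu_2$ and correlation $\rho$ (see context). Then its lower tail dependence coefficient $$\lambda_L(\rho,\nu_1,\nu_2)=\lim_{q\to0^+}\frac{C^{\rho}_{\nu_1,\nu_2}(q,q)}{q}$$ is given by $$\lambda_L(\rho,\nu_1,\nu_2)=\Omega(\rho,\nu_1,\nu_2)+\Omega(\rho,\nu_2,\nu_1),$$ where, for $a,b>0$, $$\Omega(\rho,a,b)=\int_0^\infty g_{a+1}(t)\,F_N\!\left(-\frac{B_{a,b}\,t^{a/(2b)}-\rho\sqrt t}{\sqrt{1-\rho^2}}\right)dt,\qquad B_{a,b}=\left(\frac{2^{b/2}\,\Gamma((1+b)/2)}{2^{a/2}\,\Gamma((1+a)/2)}\right)^{1/b},$$ $$g_{\nu}(t)=\frac{1}{2^{\nu/2}\Gamma(\nu/2)}e^{-t/2}t^{\nu/2-1},$$ and $F_N$ is the standard Normal cumulative distribution function.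
   Context: For $\nu>0$, let $G_\nu$ be the cumulative distribution function of $\sqrt{\nu/Q}$, where $Q$ has the Chi-square distribution with $\nu$ degrees of freedom, and $G_\nu^{-1}$ its inverse. Let $t_\nu$ be the cumulative distribution function of the standard univariate Student $t$ distribution with $\nu$ degrees of freedom. Let $(Z_1,Z_2)$ be bivariate Normal with zero means, unit variances and correlation $\rho$, and let $S$ be uniform on $(0,1)$ and independent of $(Z_1,Z_2)$. Put $W_i=G_{\nu_i}^{-1}(S)$, $X_i=W_iZ_i$ and $U_i=t_{\nu_i}(X_i)$ for $i=1,2$ (the same $S$ is used for both $W_1$ and $W_2$). The bivariate $\tilde t_{\mathbf v}$ copula is the joint distribution function $C^{\rho}_{\nu_1,\nu_2}(u_1,u_2)=\Pr(U_1\le u_1,U_2\le u_2)$, $u_1,u_2\in[0,1]$. *)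

(* Defs.v *)
From HB Require Import structures.
From mathcomp Require Import all_boot all_order all_algebra.
From mathcomp Require Import all_classical all_reals all_analysis.
Set Implicit Arguments.
Unset Strict Implicit.
Unset Printing Implicit Defensive.
Import Order.TTheory GRing.Theory Num.Theory.
Import numFieldNormedType.Exports.
Local Open Scope classical_set_scope.
Local Open Scope ring_scope.

Definition gamma_fun (R : realType) (s : R) : R :=
  \int[lebesgue_measure]_(t in `]0, +oo[) (expR (- t) * t `^ (s - 1)).

(* The guard is needed: [x `^ a] is not zero for negative [x]. *)
Definition chi2_pdf (R : realType) (nu x : R) : R :=
  if 0 < x then
    (2 `^ (nu / 2) * gamma_fun (nu / 2))^-1 * expR (- x / 2) * x `^ (nu / 2 - 1)
  else 0.

Definition chi2_prob (R : realType) (nu : R) (A : set R) : \bar R :=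
  (\int[lebesgue_measure]_(x in A) (chi2_pdf nu x)%:E)%E.

(* The distribution function of sqrt (nu / Q), with Q distributed according to
   [chi2_prob nu]; the values q <= 0 have probability 0. *)
Definition G (R : realType) (nu x : R) : R :=
  fine (chi2_prob nu [set q | Num.sqrt (nu / q) <= x]).

(* [G nu] is constant on the nonpositive reals and is a bijection from
   (0, +oo) onto (0, 1), whence the domain on which it is inverted. *)
Definition Ginv (R : realType) (nu : R) : R -> R :=
  'pinv_(fun=> 0) `]0, +oo[ (G nu).

Definition student_pdf (R : realType) (nu x : R) : R :=
  gamma_fun ((nu + 1) / 2) / (Num.sqrt (nu * pi) * gamma_fun (nu / 2)) *
  (1 + x ^+ 2 / nu) `^ (- ((nu + 1) / 2)).

Definition student_cdf (R : realType) (nu x : R) : R :=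
  \int[lebesgue_measure]_(y in `]-oo, x]) student_pdf nu y.

Definition std_normal_cdf (R : realType) (x : R) : R :=
  fine (normal_prob 0 1 `]-oo, x]).

(* Density of the centred bivariate normal law with unit variances and
   correlation rho, for -1 < rho < 1. *)
Definition binormal_pdf (R : realType) (rho : R) (z : R * R) : R :=
  (2 * pi * Num.sqrt (1 - rho ^+ 2))^-1 *
  expR (- (z.1 ^+ 2 - 2 * rho * z.1 * z.2 + z.2 ^+ 2) / (2 * (1 - rho ^+ 2))).

Definition is_binormal (R : realType) (d : measure_display)
    (T : measurableType d) (P : probability T R) (rho : R)
    (Z1 Z2 : {RV P >-> R}) : Prop :=
  forall A : set (R * R), measurable A ->
    P ((fun w => (Z1 w, Z2 w)) @^-1` A) =
    (\int[lebesgue_measure \x lebesgue_measure]_(z in A)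
       (binormal_pdf rho z)%:E)%E.

Definition is_uniform01 (R : realType) (d : measure_display)
    (T : measurableType d) (P : probability T R) (S : {RV P >-> R}) : Prop :=
  forall A : set R, measurable A ->
    distribution P S A = uniform_prob (@ltr01 R) A.

Definition independent_of_pair (R : realType) (d : measure_display)
    (T : measurableType d) (P : probability T R)
    (S Z1 Z2 : {RV P >-> R}) : Prop :=
  forall (A : set R) (B : set (R * R)), measurable A -> measurable B ->
    P (S @^-1` A `&` (fun w => (Z1 w, Z2 w)) @^-1` B) =
    (P (S @^-1` A) * P ((fun w => (Z1 w, Z2 w)) @^-1` B))%E.

Definition ttilde_margin (R : realType) (d : measure_display)
    (T : measurableType d) (P : probability T R) (nu : R)
    (S Z : {RV P >-> R}) (w : T) : R :=
  student_cdf nu (Ginv nu (S w) * Z w).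

(* The same S drives both mixing variables. *)
Definition ttilde_copula (R : realType) (d : measure_display)
    (T : measurableType d) (P : probability T R) (nu1 nu2 : R)
    (S Z1 Z2 : {RV P >-> R}) (u1 u2 : R) : R :=
  fine (P [set w | ttilde_margin nu1 S Z1 w <= u1 /\
                   ttilde_margin nu2 S Z2 w <= u2]).

Definition Bcoef (R : realType) (a b : R) : R :=
  ((2 `^ (b / 2) * gamma_fun ((1 + b) / 2)) /
   (2 `^ (a / 2) * gamma_fun ((1 + a) / 2))) `^ b^-1.

Definition Omega (R : realType) (rho a b : R) : R :=
  \int[lebesgue_measure]_(t in `]0, +oo[)
    (chi2_pdf (a + 1) t *
     std_normal_cdf (- ((Bcoef a b * t `^ (a / (2 * b)) - rho * Num.sqrt t) /
                        Num.sqrt (1 - rho ^+ 2)))).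

(* Main.v *)
Require Import Defs.
From mathcomp Require Import all_boot all_order all_algebra.
From mathcomp Require Import all_classical all_reals all_analysis.
From mathcomp Require Import measurable_realfun.
From mathcomp Require Import ring lra.
Import Order.TTheory GRing.Theory Num.Theory.
Import numFieldNormedType.Exports.
Set Implicit Arguments.
Unset Strict Implicit.
Unset Printing Implicit Defensive.
Local Open Scope classical_set_scope.
Local Open Scope ring_scope.

(** Put F_i for the chi-square distribution function with nu_i degrees of
    freedom. For x < 0 the event W_i Z_i <= x says that Z_i < 0 and
    S >= G_i(x / Z_i), where 1 - G_i(w) = F_i(nu_i / w^2). With x_i(q) the
    q-quantile of t_i, conditioning on (Z_1, Z_2) = z therefore gives

      C(q, q) / q = int_{z1, z2 < 0} phi_rho(z) min_i (F_i(nu_i z_i^2 / x_i^2) / q) dz.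

    Both F_i at 0 and t_i at -oo behave like explicit powers, so the i-th
    quotient tends to |z_i|^nu_i / alpha_i and is bounded by a multiple of
    |z_i|^nu_i; by dominated convergence the limit is
    E[min_i |Z_i|^nu_i / alpha_i ; Z_1, Z_2 < 0]. Splitting it according to
    which term is the smaller one, integrating the other variable out against
    its conditional normal law, and substituting z = - sqrt t gives the two
    values of Omega. *)

(** * Improper integration by substitution *)

(** The constant alpha_i has two meanings. It is the Student tail constant divided by the tail
    constant of W_i ([tail_coefE]), and it is the moment E[|Z_i|^nu_i ; Z_i < 0]
    ([half_normal_moment]). The two must agree because W_i Z_i has the Student law; here both are
    computed in closed form. The second meaning makes |z_1|^nu_1 / alpha_1 on z_1 < 0 an integrable
    bound of total mass 1, and turns the weighted half-normal density into the chi-square density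
    with a + 1 degrees of freedom that occurs in Omega. The powers at 0 and -oo come from enclosing
    each distribution function between two explicit multiples of one power, the ratio of the bounds
    tending to 1. The same enclosure gives the domination; for it to be uniform in q, the quantiles
    must stay away from 0, so q is taken small enough for both to be at most -1. A minimum appears,
    and not a product, because a single S drives both W_i. The coefficient B comes from solving
    |x|^a / alpha_a = |y|^b / alpha_b for y. Dominated convergence is sequential, so q runs through
    an arbitrary positive sequence tending to 0. *)

Section exhaustion.
Context {R : realType}.
Notation mu := (@lebesgue_measure R).

(** Monotone convergence on both sides and uniqueness of the limit: this carries a change of
    variables from bounded pieces, where the integrand is continuous up to the ends, to the whole
    domain. *)
Lemma ge0_integral_exhaust (A B : (set R)^nat) (f g : R -> \bar R) :
  nondecreasing_seq A -> nondecreasing_seq B ->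
  (forall n, measurable (A n)) -> (forall n, measurable (B n)) ->
  (forall n, measurable_fun (A n) f) -> (forall n, measurable_fun (B n) g) ->
  (forall n x, A n x -> (0 <= f x)%E) -> (forall n x, B n x -> (0 <= g x)%E) ->
  (forall n, (\int[mu]_(x in A n) f x = \int[mu]_(x in B n) g x)%E) ->
  (\int[mu]_(x in \bigcup_n A n) f x = \int[mu]_(x in \bigcup_n B n) g x)%E.
Proof.
move=> ndA ndB mA mB mf mg f0 g0 fg.
have cA : (\int[mu]_(x in A i) f x)%E @[i --> \oo] -->
    (\int[mu]_(x in \bigcup_i A i) f x)%E.
  exact: ge0_nondecreasing_set_cvg_integral.
have cB : (\int[mu]_(x in B i) g x)%E @[i --> \oo] -->
    (\int[mu]_(x in \bigcup_i B i) g x)%E.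
  exact: ge0_nondecreasing_set_cvg_integral.
move: cA; under eq_fun do rewrite fg.
by move=> cA; exact: (cvg_unique _ cA cB).
Qed.

Lemma continuous_at_within (f : R -> R) (A : set R) :
  (forall x, A x -> {for x, continuous f}) -> {within A, continuous f}.
Proof.
by move=> cf; apply: continuous_in_subspaceT => x; rewrite inE => Ax; exact: cf.
Qed.

Lemma continuous_at_measurable (f : R -> R) (A : set R) : measurable A ->
  (forall x, A x -> {for x, continuous f}) -> measurable_fun A f.
Proof.
by move=> mA /continuous_at_within; exact: subspace_continuous_measurable_fun.
Qed.

Lemma continuous_at_emeasurable (f : R -> R) (A : set R) : measurable A ->
  (forall x, A x -> {for x, continuous f}) ->
  measurable_fun A (fun x => (f x)%:E).
Proof.
by move=> mA cf; apply/measurable_EFinP; exact: continuous_at_measurable.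
Qed.

Lemma bigcup_itv_oy :
  \bigcup_n `[n.+1%:R^-1, n.+1%:R]%classic = `]0, +oo[%classic :> set R.
Proof.
apply/seteqP; split => [x [n _]/=|x/=].
  rewrite !in_itv/= andbT => /andP[+ _]; apply: lt_le_trans.
  by rewrite invr_gt0.
rewrite in_itv/= andbT => x0.
(* The successor of this integer exceeds both [x] and [x^-1], as the two ends of the segment
   require. *)
exists (Num.truncn (Num.max x x^-1)) => //=.
have /andP[_ h] : (Num.truncn (Num.max x x^-1))%:R <= Num.max x x^-1
     < (Num.truncn (Num.max x x^-1)).+1%:R.
  by apply: truncn_itv; rewrite le_max (ltW x0).
rewrite in_itv/=; apply/andP; split.
  rewrite -[leRHS]invrK lef_pV2 ?posrE ?invr_gt0//.
  by apply: le_trans (ltW h); rewrite le_max lexx orbT.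
by apply: le_trans (ltW h); rewrite le_max lexx.
Qed.

Lemma nd_itv_oy : nondecreasing_seq (fun n => `[n.+1%:R^-1, n.+1%:R]%classic : set R).
Proof.
move=> m n mn; rewrite subsetEset; apply: subset_itvScc; rewrite bnd_simp.
  by rewrite lef_pV2 ?posrE// ler_nat.
by rewrite ler_nat.
Qed.

(** Substitution holds on each segment [1/(n+1), n+1]. As [F] increases from 0 to infinity, the
    image segments exhaust the half-line as well. Nothing is asked at 0, where the integrands used
    later may blow up. *)
Lemma ge0_integration_by_substitution_oy (F f G : R -> R) :
  (forall x : R, 0 < x -> is_derive x 1 F (f x)) ->
  (forall x : R, 0 < x -> 0 < f x) ->
  (forall x : R, 0 < x -> {for x, continuous f}) ->
  (forall x : R, 0 < x -> 0 < F x) ->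
  F x @[x --> 0^'+] --> 0 -> F x @[x --> +oo] --> +oo ->
  (forall x : R, 0 < x -> {for x, continuous G}) ->
  (forall x : R, 0 < x -> 0 <= G x) ->
  (\int[mu]_(x in `]0%R, +oo[) (G x)%:E =
   \int[mu]_(x in `]0%R, +oo[) (G (F x) * f x)%:E)%E.
Proof.
move=> dF f0 cf F0 Fr Fy cG G0.
have derF x : 0 < x -> derivable F x 1 by move=> /dF[].
have F'E x : 0 < x -> F^`()%classic x = f x.
  by move=> x0; rewrite derive1E; apply: derive_val; exact: dF.
have cF x : 0 < x -> {for x, continuous F}.
  by move=> /derF /derivable1_diffP; exact: differentiable_continuous.
have Finc x y : 0 < x -> x < y -> F x < F y.
  move=> x0 xy.
  have x'0 u : u \in `]x, y[ -> 0 < u.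
    by rewrite in_itv/= => /andP[+ _]; exact: lt_trans.
  apply: (@gtr0_derive1_incr _ F x y) => //.
  - by move=> u /x'0 u0; exact: derF.
  - by move=> u /x'0 u0; rewrite F'E// f0.
  - apply: continuous_at_within => u/=; rewrite in_itv/= => /andP[xu _].
    by apply: cF; exact: lt_le_trans xu.
have Fle x y : 0 < x -> x <= y -> F x <= F y.
  by move=> x0; rewrite le_eqVlt => /predU1P[->//|/(Finc _ _ x0)/ltW].
have nS0 n : (0 < n.+1%:R^-1 :> R) by rewrite invr_gt0.
have nSle n : (n.+1%:R^-1 <= n.+1%:R :> R).
  by rewrite (@le_trans _ _ 1)// ?invf_le1// ler1n.
have UF : `]0, +oo[%classic =
    \bigcup_n `[F n.+1%:R^-1, F n.+1%:R]%classic :> set R.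
  apply/seteqP; split => [y/=|y [n _]/=]; last first.
    rewrite !in_itv/= andbT => /andP[+ _]; apply: lt_le_trans; exact: F0.
  rewrite in_itv/= andbT => y0.
  have : \forall x \near 0^'+, F x < y.
    by move/cvgr_lt : Fr; exact.
  case=> e /= e0 he.
  move/cvgryPge : Fy => /(_ y)[M [_ hM]].
  (* [e / 2] is a point where [F] is below [y], and [Num.max 1 (M + 1)] one where it is above. An
     index whose segment contains both points works, since [F] is increasing. *)
  have xe : 0 < e / 2 by rewrite divr_gt0.
  have : (\bigcup_n `[n.+1%:R^-1, n.+1%:R]%classic : set R) (e / 2).
    by rewrite bigcup_itv_oy/= in_itv/= andbT.
  case=> n1 _ /=; rewrite in_itv/= => /andP[n1e _].
  have : (\bigcup_n `[n.+1%:R^-1, n.+1%:R]%classic : set R) (Num.max 1 (M + 1)).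
    by rewrite bigcup_itv_oy/= in_itv/= andbT lt_max ltr01.
  case=> n2 _ /=; rewrite in_itv/= => /andP[_ n2M].
  exists (maxn n1 n2) => //=; rewrite in_itv/=; apply/andP; split.
    apply: (@le_trans _ _ (F (e / 2))).
      apply: Fle => //; apply: le_trans n1e.
      by rewrite lef_pV2 ?posrE// ler_nat ltnS leq_maxl.
    apply/ltW/he => //=.
    by rewrite distrC subr0 gtr0_norm// gtr_pMr// invf_lt1// ltr1n.
  apply: (@le_trans _ _ (F (Num.max 1 (M + 1)))).
    by apply: hM; rewrite lt_max ltrDl ltr01 orbT.
  apply: Fle; first by rewrite lt_max ltr01.
  by apply: (le_trans n2M); rewrite ler_nat ltnS leq_maxr.
rewrite [in LHS]UF -bigcup_itv_oy.
have cGF x : 0 < x -> {for x, continuous (fun x => G (F x) * f x)}.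
  move=> x0; apply: cvgM; last exact: cf.
  by apply: (@continuous_comp _ _ _ F G); [exact: cF|exact/cG/F0].
apply: ge0_integral_exhaust.
- move=> m n mn; rewrite subsetEset; apply: subset_itvScc; rewrite bnd_simp.
    by apply: Fle => //; rewrite lef_pV2 ?posrE// ler_nat.
  by apply: Fle => //; rewrite ler_nat.
- exact: nd_itv_oy.
- by move=> n; exact: measurable_itv.
- by move=> n; exact: measurable_itv.
- move=> n; apply: continuous_at_emeasurable; [exact: measurable_itv|move=> x/=].
  rewrite in_itv/= => /andP[+ _] => h; apply: cG; apply: lt_le_trans h; exact: F0.
- move=> n; apply: continuous_at_emeasurable; [exact: measurable_itv|move=> x/=].
  rewrite in_itv/= => /andP[+ _] => h; apply: cGF; exact: lt_le_trans h.
- move=> n x/=.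
  rewrite in_itv/= => /andP[+ _] => h; rewrite lee_fin; apply: G0; apply: lt_le_trans h; exact: F0.
- move=> n x/=.
  rewrite in_itv/= => /andP[+ _] => h.
  have x0 : 0 < x by exact: lt_le_trans h.
  by rewrite lee_fin mulr_ge0// ?G0 ?F0//; apply/ltW/f0.
move=> n; rewrite (@integration_by_substitution_increasing _ F)//.
- apply: eq_integral => x; rewrite inE/= in_itv/= => /andP[xn _].
  rewrite fctE/= F'E//; exact: lt_le_trans xn.
- move=> x y; rewrite !in_itv/= => /andP[xn _] _; apply: Finc.
  exact: lt_le_trans xn.
- move=> x; rewrite in_itv/= => /andP[xn _].
  have x0 : 0 < x by exact: lt_trans xn.
  have := cf _ x0; rewrite /prop_for /continuous_at F'E//.
  apply: cvg_trans; apply: near_eq_cvg; near=> y; rewrite F'E//.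
  by near: y; exact: lt_nbhsr.
- apply/cvg_ex; exists (f n.+1%:R^-1).
  have := cvg_at_right_filter (cf _ (nS0 n)).
  apply: cvg_trans; apply: near_eq_cvg; near=> y; rewrite F'E//.
  by apply: (lt_trans (nS0 n)); near: y; exact: nbhs_right_gt.
- apply/cvg_ex; exists (f n.+1%:R).
  have := cvg_at_left_filter (cf n.+1%:R (ltr0Sn _ _)).
  apply: cvg_trans; apply: near_eq_cvg; near=> y; rewrite F'E//.
- split.
  + move=> x; rewrite in_itv/= => /andP[xn _]; apply: derF; exact: lt_trans xn.
  + exact/cvg_at_right_filter/cF.
  + exact/cvg_at_left_filter/cF.
- apply: continuous_at_within => x/=; rewrite in_itv/= => /andP[xn _].
  by apply: cG; apply: lt_le_trans xn; exact: F0.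
Unshelve. all: by end_near. Qed.

Lemma ge0_integration_by_substitution_Nyo (G : R -> R) :
  (forall x : R, x < 0 -> {for x, continuous G}) ->
  (forall x : R, x < 0 -> 0 <= G x) ->
  (\int[mu]_(x in `]-oo, 0%R[) (G x)%:E = \int[mu]_(x in `]0%R, +oo[) (G (- x)%R)%:E)%E.
Proof.
move=> cG G0.
have nS0 n : (0 < n.+1%:R^-1 :> R) by rewrite invr_gt0.
have Uy : `]0, +oo[%classic = \bigcup_n `[n.+1%:R^-1, +oo[%classic :> set R.
  rewrite -bigcup_itv_oy; apply/seteqP; split => x [n _]/=; rewrite in_itv/=.
    by move=> /andP[xn _]; exists n => //=; rewrite in_itv/= xn.
  rewrite andbT => xn; rewrite bigcup_itv_oy/= in_itv/= andbT.
  exact: lt_le_trans xn.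
have UNy : `]-oo, 0[%classic = \bigcup_n `]-oo, (- n.+1%:R^-1)]%classic :> set R.
  apply/seteqP; split => x/=.
    rewrite in_itv/= -oppr_gt0 => x0.
    have : (`]0, +oo[%classic : set R) (- x) by rewrite /= in_itv/= x0.
    rewrite Uy => -[n _ /=]; rewrite in_itv/= andbT lerNr => h.
    by exists n => //=; rewrite in_itv.
  case=> n _ /=; rewrite !in_itv/= => /le_lt_trans; apply.
  by rewrite oppr_lt0.
rewrite UNy Uy.
have cGN x : 0 < x -> {for x, continuous (fun x => G (- x))}.
  move=> x0; apply: (@continuous_comp _ _ _ -%R G); first exact: continuousN.
  by apply: cG; rewrite oppr_lt0.
apply: ge0_integral_exhaust.
- move=> m n mn; rewrite subsetEset; apply: subset_itvl; rewrite bnd_simp.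
  by rewrite lerN2 lef_pV2 ?posrE// ler_nat.
- move=> m n mn; rewrite subsetEset; apply: subset_itvr; rewrite bnd_simp.
  by rewrite lef_pV2 ?posrE// ler_nat.
- by move=> n; exact: measurable_itv.
- by move=> n; exact: measurable_itv.
- move=> n; apply: continuous_at_emeasurable; [exact: measurable_itv|move=> x/=].
  by rewrite in_itv/= => h; apply: cG; apply: (le_lt_trans h); rewrite oppr_lt0.
- move=> n; apply: continuous_at_emeasurable; [exact: measurable_itv|move=> x/=].
  rewrite in_itv/= andbT => h; apply: cGN; exact: lt_le_trans h.
- move=> n x/=.
  by rewrite in_itv/= => h; rewrite lee_fin; apply: G0; apply: (le_lt_trans h); rewrite oppr_lt0.
- move=> n x/=; rewrite in_itv/= andbT => h; rewrite lee_fin; apply: G0.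
  by rewrite oppr_lt0; exact: lt_le_trans h.
move=> n; rewrite ge0_integration_by_substitutionNy//.
- apply: continuous_at_within => x/=; rewrite in_itv/= => h.
  by apply: cG; apply: (le_lt_trans h); rewrite oppr_lt0.
- move=> x; rewrite in_itv/= => h; apply: G0; apply: (lt_trans h).
  by rewrite oppr_lt0.
Qed.

End exhaustion.

(** * Densities and powers *)

Section density.
Local Open Scope ereal_scope.
Context d (T : measurableType d) (R : realType).
Variables (mu nu : {measure set T -> \bar R}) (p : T -> R).
Hypotheses (mp : measurable_fun setT p) (p0 : forall x, (0 <= p x)%R).
Hypothesis nuE : forall A, measurable A -> nu A = \int[mu]_(x in A) (p x)%:E.

Import HBNNSimple.

(** The density is given on sets only. It passes to simple functions by linearity and to [f] by
    monotone convergence. It serves to rewrite integrals against the law of (Z1, Z2) as Lebesgue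
    integrals. *)
Lemma ge0_integral_density (f : T -> \bar R) : measurable_fun setT f ->
  (forall x, 0 <= f x) ->
  \int[nu]_x f x = \int[mu]_x (f x * (p x)%:E).
Proof.
move=> mf f0; pose h := nnsfun_approx measurableT mf.
pose g x := (p x)%:E.
have mg : measurable_fun setT g by exact/measurable_EFinP.
have g0 x : 0 <= g x by rewrite lee_fin.
have hf x : (EFin \o (h ^~ x)) n @[n --> \oo] --> f x.
  exact: cvg_nnsfun_approx.
have mh n : measurable_fun setT (EFin \o h n) by exact/measurable_EFinP.
have hnd x : {homo (fun n => (h n x)%:E) : m n / (m <= n)%N >-> m <= n}.
  by move=> m n mn; rewrite lee_fin; exact/lefP/nd_nnsfun_approx.
have -> : \int[nu]_x f x = limn (fun n => \int[nu]_x (EFin \o h n) x).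
  under eq_integral do rewrite -(cvg_lim _ (hf _))//.
  apply: monotone_convergence => //.
  - by move=> n x _; rewrite lee_fin.
  - by move=> x _; exact: hnd.
have -> : \int[mu]_x (f x * g x) =
    limn (fun n => \int[mu]_x ((EFin \o h n) \* g) x).
  have fg x : ((EFin \o h n) \* g) x @[n --> \oo] --> f x * g x.
    by apply: cvgeZr => //; exact: hf.
  under eq_integral do rewrite -(cvg_lim _ (fg _))//.
  apply: monotone_convergence => //.
  - by move=> n; exact: emeasurable_funM.
  - by move=> n x _; rewrite mule_ge0// lee_fin.
  - by move=> x _ a b ab; rewrite lee_wpmul2r//; exact: hnd.
congr (limn _); apply/funext => n.
transitivity (\int[nu]_x
   (\sum_(y \in range (h n)) (y * \1_(h n @^-1` [set y]) x)%:E)).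
  by apply: eq_integral => t _; rewrite /= fimfunE -fsumEFin.
have indich r : measurable_fun setT (fun x => (r * \1_(h n @^-1` [set r]) x)%:E).
  by apply/measurable_EFinP; exact: measurable_funM.
rewrite ge0_integral_fsum//; last by move=> m y Ey; exact: nnfun_muleindic_ge0.
transitivity (\int[mu]_x (\sum_(y \in range (h n))
    (y * \1_(h n @^-1` [set y]) x)%:E * g x)); last first.
  apply: eq_integral => x _.
  rewrite -ge0_mule_fsuml => [|y]; last exact: nnfun_muleindic_ge0.
  by rewrite fsumEFin // -(fimfunE _ x).
rewrite ge0_integral_fsum//; last 2 first.
  - by move=> y; exact: emeasurable_funM.
  - by move=> m y Ey; rewrite mule_ge0// nnfun_muleindic_ge0.
apply: eq_fsbigr => r rhn.
under eq_integral do rewrite EFinM.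
rewrite integralZl_indic_nnsfun => //.
under [RHS]eq_integral do rewrite EFinM -muleA.
rewrite ge0_integralZl//.
- under [in RHS]eq_integral do rewrite muleC.
  rewrite [in RHS](eq_integral (g \_ (h n @^-1` [set r]))); last first.
    by move=> x xE; rewrite epatch_indic.
  by rewrite -integral_mkcond -nuE// integral_indic// setIT.
- apply: emeasurable_funM => //; exact/measurable_EFinP.
- by move=> t Et; rewrite mule_ge0 ?lee_fin.
- by move: rhn; rewrite inE => -[t _ <-]; rewrite lee_fin.
Qed.

End density.

Section powers.
Context {R : realType}.
Notation mu := (@lebesgue_measure R).

Lemma continuous_powR_gt0 (a x : R) : 0 < x -> {for x, continuous (fun t : R => t `^ a)}.
Proof.
move=> x0; apply/differentiable_continuous/derivable1_diffP.
by apply: derivable_powR; rewrite in_itv/= x0.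
Qed.

Lemma powR_cvgy (s : R) : 0 < s -> t `^ (- s) @[t --> +oo] --> (0 : R).
Proof.
move=> s0; apply/cvgrPdist_lt => e e0.
have : (t `^ s) @[t --> (0:R)^'+] --> (0 : R) by exact: powR_cvg0.
move/cvgrPdist_lt => /(_ _ e0)[r /= r0 hr].
near=> t.
have t0 : 0 < t by near: t; exact: nbhs_pinfty_gt.
have : t^-1 < r.
  rewrite -[ltRHS]invrK ltf_pV2 ?posrE ?invr_gt0//.
  by near: t; apply: nbhs_pinfty_gt; rewrite num_real.
have -> : t `^ (- s) = t^-1 `^ s.
  by rewrite -(powR_inv1 (ltW t0)) -powRrM mulN1r.
by move=> tr; apply: hr => //=; rewrite ?invr_gt0// distrC subr0 gtr0_norm// invr_gt0.
Unshelve. all: by end_near. Qed.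

Lemma is_derive_powR_div (s x : R) : s != 0 -> 0 < x ->
  is_derive x 1 (fun t : R => t `^ s / s) (x `^ (s - 1)).
Proof.
move=> s0 x0; have := is_derive1_powR s x0 => h.
have -> : x `^ (s - 1) = s^-1 *: (s * x `^ (s - 1)).
  by rewrite /GRing.scale/= mulKf.
have -> : (fun t : R => t `^ s / s) = s^-1 \*: (fun t : R => t `^ s).
  by apply/funext => t/=; rewrite /GRing.scale/= mulrC.
exact: is_deriveZ.
Qed.

(** For [s < 1] the integrand is unbounded at 0, so the fundamental theorem is applied away from 0
    and the lower end then tends to 0. *)
Lemma integral_powR_0y (s y : R) : 0 < s -> 0 < y ->
  (\int[mu]_(t in `]0%R, y]) (t `^ (s - 1))%:E = (y `^ s / s)%:E)%E.
Proof.
move=> s0 y0.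
have sn0 : s != 0 by rewrite gt_eqF.
(* With [n.+2] in place of [n.+1] the first segment is not reduced to a point, as the fundamental
   theorem requires. *)
pose A n := (`[y / n.+2%:R, y]%classic : set R).
have yn n : 0 < y / n.+2%:R by rewrite divr_gt0.
have yny n : y / n.+2%:R < y.
  by rewrite ltr_pdivrMr// ltr_pMr// ltr1n.
have UA : `]0, y]%classic = \bigcup_n A n.
  apply/seteqP; split => [x/=|x [n _]]; rewrite /A/= !in_itv/=.
    move=> /andP[x0 xy].
    exists (Num.truncn (y / x)) => //=; rewrite in_itv/= xy andbT.
    have /andP[_ h] : (Num.truncn (y / x))%:R <= y / x < (Num.truncn (y / x)).+1%:R.
      by apply: truncn_itv; rewrite divr_ge0 ?ltW.
    rewrite ler_pdivrMr// mulrC -ler_pdivrMr//; apply: (le_trans (ltW h)).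
    by rewrite ler_nat.
  by move=> /andP[h ->]; rewrite (lt_le_trans _ h).
have cf x : 0 < x -> {for x, continuous (fun t : R => t `^ (s - 1))}.
  exact: continuous_powR_gt0.
have c1 : (\int[mu]_(t in A n) (t `^ (s - 1))%:E)%E @[n --> \oo] -->
    (\int[mu]_(t in \bigcup_n A n) (t `^ (s - 1))%:E)%E.
  apply: ge0_nondecreasing_set_cvg_integral.
  - move=> m n mn; rewrite subsetEset; apply: subset_itvr; rewrite bnd_simp.
    by rewrite ler_pM2l// lef_pV2 ?posrE// ler_nat.
  - by move=> n; exact: measurable_itv.
  - move=> n; apply: continuous_at_emeasurable; first exact: measurable_itv.
    move=> x; rewrite /A/= in_itv/= => /andP[h _]; apply: cf.
    exact: lt_le_trans h.
  - by move=> n x _; rewrite lee_fin powR_ge0.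
rewrite UA.
have FTC n : (\int[mu]_(t in A n) (t `^ (s - 1))%:E =
    (y `^ s / s)%:E - ((y / n.+2%:R) `^ s / s)%:E)%E.
  have dF (x : R) : 0 < x -> is_derive x 1 (fun t : R => t `^ s / s) (x `^ (s - 1)).
    exact: is_derive_powR_div.
  have cF (x : R) : 0 < x -> {for x, continuous (fun t : R => t `^ s / s)}.
    move=> /dF[+ _] => /derivable1_diffP; exact: differentiable_continuous.
  apply: (@continuous_FTC2 _ (fun t : R => t `^ (s - 1)) (fun t : R => t `^ s / s)) => //.
  - apply: continuous_at_within => x; rewrite /= in_itv/= => /andP[h _].
    apply: cf; exact: lt_le_trans h.
  - split.
    + move=> x; rewrite in_itv/= => /andP[h _]; 
      by have [] := dF x (lt_trans (yn n) h).
    + exact/cvg_at_right_filter/cF.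
    + exact/cvg_at_left_filter/cF.
  - move=> x; rewrite in_itv/= => /andP[h _].
    rewrite derive1E; apply: derive_val; apply: dF; exact: lt_trans h.
suff c2 : (\int[mu]_(t in A n) (t `^ (s - 1))%:E)%E @[n --> \oo] -->
    (y `^ s / s)%:E.
  exact: (cvg_unique _ c1 c2).
under eq_fun do rewrite FTC -EFinB.
apply: cvg_EFin; first by near=> n.
rewrite -[X in _ --> X]subr0; apply: cvgB; first exact: cvg_cst.
rewrite -[X in _ --> X](mul0r s^-1); apply: cvgMl.
have /cvg_at_rightP := powR_cvg0 s0; apply; split => //.
rewrite -[X in _ --> X](mulr0 y); apply: cvgM; first exact: cvg_cst.
have := @cvg_harmonic R; rewrite -(cvg_shiftS (fun n => n.+1%:R^-1 : R)).
exact.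
Unshelve. all: by end_near. Qed.

Lemma integral_powR_tail (s x : R) : 0 < s -> 0 < x ->
  (\int[mu]_(t in `[x, +oo[) (t `^ (- s - 1))%:E = (x `^ (- s) / s)%:E)%E.
Proof.
move=> s0 x0.
have sn0 : - s != 0 by rewrite oppr_eq0 gt_eqF.
have dF (t : R) : 0 < t -> is_derive t 1 (fun t : R => t `^ (- s) / (- s)) (t `^ (- s - 1)).
  exact: is_derive_powR_div.
rewrite (@ge0_continuous_FTC2y _ _ (fun t : R => t `^ (- s) / (- s)) _ 0).
- by rewrite -EFinB sub0r invrN mulrN opprK.
- by move=> t _; exact: powR_ge0.
- apply: continuous_at_within => t; rewrite /= in_itv/= andbT => h.
  apply: continuous_powR_gt0; exact: lt_le_trans h.
- rewrite -[X in _ --> X](mul0r (- s)^-1); apply: cvgMl; exact: powR_cvgy.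
- by move=> t xt; have [] := dF t (lt_trans x0 xt).
- apply: cvg_at_right_filter; have [+ _] := dF _ x0.
  by move=> /derivable1_diffP; exact: differentiable_continuous.
- move=> t; rewrite in_itv/= andbT => h.
  rewrite derive1E; apply: derive_val; apply: dF; exact: lt_trans h.
Qed.

End powers.

(** * The gamma and chi-square integrals *)

Section cdf.
Context {R : realType}.
Notation mu := (@lebesgue_measure R).

Lemma derive_cdf (f : R -> R) (x : R) :
  (forall u, mu.-integrable `]-oo, u] (EFin \o f)) -> {for x, continuous f} ->
  is_derive x 1 (fun y => \int[mu]_(t in `]-oo, y]) f t) (f x).
Proof.
move=> intf cf.
have xx : x < x + 1 by rewrite ltrDl.
have [dF F'] := @continuous_FTC1 R f -oo%O x (x + 1) xx (intf _) (ltNyr _) cf.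
by split; [exact: dF|rewrite -derive1E; exact: F'].
Qed.

End cdf.

Section gamma.
Context {R : realType}.
Notation mu := (@lebesgue_measure R).

Lemma measurable_cst_powR (c a : R) (A : set R) :
  measurable_fun A (fun t : R => c * t `^ a).
Proof.
apply: measurable_funTS.
by apply: measurable_funM; [exact: measurable_cst|exact: measurable_powR].
Qed.

Lemma measurable_gamma_integrand (s : R) (A : set R) :
  measurable_fun A (fun t : R => expR (- t) * t `^ (s - 1)).
Proof.
apply: measurable_funTS; apply: measurable_funM; last exact: measurable_powR.
by apply: (measurableT_comp (@measurable_expR R)); exact: measurable_funN.
Qed.

Lemma gamma_integrand_ge0 (s t : R) : 0 <= expR (- t) * t `^ (s - 1).
Proof. by rewrite mulr_ge0 ?expR_ge0 ?powR_ge0. Qed.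

(** Up to 1 the exponential is at most 1 and a power integrable at 0 remains; beyond 1 the
    exponential beats every power, and a multiple of t^(-2) remains. *)
Lemma gamma_integral_lty (s : R) : 0 < s ->
  (\int[mu]_(t in `]0%R, +oo[) (expR (- t) * t `^ (s - 1))%:E < +oo)%E.
Proof.
move=> s0.
have -> : `]0, +oo[%classic = `]0, 1]%classic `|` `]1, +oo[%classic :> set R.
  by rewrite -itv_bndbnd_setU// bnd_simp.
rewrite ge0_integral_setU//=; last 3 first.
- by apply/measurable_EFinP; exact: measurable_gamma_integrand.
- by move=> x _; rewrite lee_fin gamma_integrand_ge0.
- apply/disj_setPS => x/= [] /=; rewrite !in_itv/= andbT => /andP[_ h1].
  by move=> /(le_lt_trans h1); rewrite ltxx.
apply: lte_add_pinfty.
  apply: (@le_lt_trans _ _ (\int[mu]_(t in `]0%R, 1%R]) (t `^ (s - 1))%:E)%E).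
    apply: ge0_le_integral => //=.
    - by move=> x _; rewrite lee_fin gamma_integrand_ge0.
    - by apply/measurable_EFinP; exact: measurable_gamma_integrand.
    - by apply/measurable_EFinP/measurable_funTS; exact: measurable_powR.
    - move=> x; rewrite in_itv/= => /andP[x0 _]; rewrite lee_fin.
      by rewrite ler_piMl ?powR_ge0// -expR0 ler_expR oppr_le0 ltW.
  by rewrite integral_powR_0y// ltry.
(* The exponent is chosen so that x^(s-1) = x^p x^(-2); then exp x = (exp (x/p))^p >= (x/p)^p. *)
pose p := s + 1; have p0 : 0 < p by rewrite addr_gt0.
apply: (@le_lt_trans _ _ (\int[mu]_(t in `]1%R, +oo[)
    (p `^ p * t `^ (- 1 - 1))%:E)%E).
  apply: ge0_le_integral => //=.
  - by move=> x _; rewrite lee_fin gamma_integrand_ge0.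
  - by apply/measurable_EFinP; exact: measurable_gamma_integrand.
  - by apply/measurable_EFinP; exact: measurable_cst_powR.
  - move=> x; rewrite in_itv/= andbT => x1; rewrite lee_fin.
    have x0 : 0 < x by exact: lt_trans x1.
    have e : (x / p) `^ p <= expR x.
      rewrite -[in expR x](divfK (lt0r_neq0 p0) x) expRM.
      rewrite ge0_ler_powR ?nnegrE ?expR_ge0 ?divr_ge0 ?(ltW p0) ?(ltW x0)//.
      by apply: le_trans (expR_ge1Dx _); rewrite lerDr.
    rewrite expRN ler_pdivrMl ?expR_gt0//.
    have -> : x `^ (s - 1) = (x / p) `^ p * (p `^ p * x `^ (-1 - 1)).
      rewrite mulrA -powRM ?divr_ge0 ?(ltW p0) ?(ltW x0)// divfK ?gt_eqF//.
      rewrite -powRD; last by rewrite (gt_eqF x0) implybT.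
      by congr (_ `^ _); rewrite /p; ring.
    by rewrite ler_wpM2r// mulr_ge0 ?powR_ge0.
rewrite integral_itv_obnd_cbnd; last first.
  by apply/measurable_EFinP; exact: measurable_cst_powR.
under eq_integral do rewrite EFinM.
rewrite ge0_integralZl//; last 3 first.
- apply/measurable_EFinP/measurable_funTS; exact: measurable_powR.
- by move=> x _; rewrite lee_fin powR_ge0.
- by rewrite lee_fin powR_ge0.
by rewrite integral_powR_tail// -EFinM ltry.
Qed.

Lemma gamma_funE (s : R) : 0 < s ->
  (\int[mu]_(t in `]0%R, +oo[) (expR (- t) * t `^ (s - 1))%:E =
   (gamma_fun s)%:E)%E.
Proof.
move=> s0; rewrite /gamma_fun /Rintegral fineK// ge0_fin_numE.
  exact: gamma_integral_lty.
by apply: integral_ge0 => x _; rewrite lee_fin gamma_integrand_ge0.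
Qed.

(** On (0, 1] the exponential factor is at least exp (-1), which leaves a positive integral of a
    power. *)
Lemma gamma_fun_gt0 (s : R) : 0 < s -> 0 < gamma_fun s.
Proof.
move=> s0; rewrite -lte_fin -gamma_funE//.
apply: (@lt_le_trans _ _ (\int[mu]_(t in `]0%R, 1%R])
   (expR (-1) * t `^ (s - 1))%:E)%E).
  under eq_integral do rewrite EFinM.
  rewrite ge0_integralZl//; last 2 first.
  - apply/measurable_EFinP/measurable_funTS; exact: measurable_powR.
  - by move=> x _; rewrite lee_fin powR_ge0.
  by rewrite integral_powR_0y// -EFinM lte_fin mulr_gt0 ?expR_gt0// divr_gt0// powR_gt0.
apply: (@le_trans _ _ (\int[mu]_(t in `]0%R, 1%R])
   (expR (-t) * t `^ (s - 1))%:E)%E).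
  apply: ge0_le_integral => //=.
  - by move=> x _; rewrite lee_fin mulr_ge0 ?expR_ge0 ?powR_ge0.
  - by apply/measurable_EFinP; exact: measurable_cst_powR.
  - by apply/measurable_EFinP; exact: measurable_gamma_integrand.
  - move=> x; rewrite in_itv/= => /andP[x0 x1]; rewrite lee_fin.
    by rewrite ler_wpM2r ?powR_ge0// ler_expR lerN2.
apply: ge0_subset_integral => //=.
- by apply/measurable_EFinP; exact: measurable_gamma_integrand.
- by move=> x _; rewrite lee_fin gamma_integrand_ge0.
- by apply: subset_itvl; rewrite bnd_simp.
Qed.

End gamma.

Section chi2.
Context {R : realType}.
Notation mu := (@lebesgue_measure R).
Variable nu : R.
Hypothesis nu0 : 0 < nu.

Definition chi2_const := (2 `^ (nu / 2) * gamma_fun (nu / 2))^-1.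

Let nu20 : 0 < nu / 2. Proof. by rewrite divr_gt0. Qed.

Lemma chi2_const_gt0 : 0 < chi2_const.
Proof. by rewrite invr_gt0 mulr_gt0 ?powR_gt0 ?gamma_fun_gt0. Qed.

Lemma chi2_pdf_ge0 x : 0 <= chi2_pdf nu x.
Proof.
rewrite /chi2_pdf; case: ifP => // _.
by rewrite !mulr_ge0 ?expR_ge0 ?powR_ge0// ltW// chi2_const_gt0.
Qed.

Lemma chi2_pdf_gt0 x : 0 < x -> 0 < chi2_pdf nu x.
Proof.
move=> x0; rewrite /chi2_pdf x0 !mulr_gt0 ?expR_gt0 ?powR_gt0//.
exact: chi2_const_gt0.
Qed.

Lemma chi2_pdf_posE x : 0 < x ->
  chi2_pdf nu x = chi2_const * (expR (- x / 2) * x `^ (nu / 2 - 1)).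
Proof. by move=> x0; rewrite /chi2_pdf x0 mulrA. Qed.

Lemma measurable_chi2_pdf (A : set R) : measurable_fun A (chi2_pdf nu).
Proof.
apply: measurable_funTS; apply: measurable_fun_ifT => //.
  by apply: measurable_fun_ltr.
apply: measurable_funM; last exact: measurable_powR.
apply: measurable_funM => //; apply: (measurableT_comp (@measurable_expR R)).
by apply: measurable_funM => //; exact: measurable_funN.
Qed.

Lemma continuous_chi2_pdf x : 0 < x -> {for x, continuous (chi2_pdf nu)}.
Proof.
move=> x0.
have : {for x, continuous (fun x : R => chi2_const * (expR (- x / 2) * x `^ (nu / 2 - 1)))}.
  apply: cvgM; first exact: cvg_cst.
  apply: cvgM; last exact: continuous_powR_gt0.
  apply: (@continuous_comp _ _ _ (fun x : R => - x / 2) expR); last exact: continuous_expR.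
  by apply: cvgMl; exact: continuousN.
rewrite /prop_for /continuous_at -chi2_pdf_posE//; apply: cvg_trans.
apply: near_eq_cvg; near=> y; rewrite chi2_pdf_posE//.
by near: y; exact: lt_nbhsr.
Unshelve. all: by end_near. Qed.

(** The substitution t = x/2 produces the gamma integral, and the powers of 2 cancel against
    [chi2_const]. *)
Lemma integral_chi2_pdf_pos : (\int[mu]_(x in `]0%R, +oo[) (chi2_pdf nu x)%:E = 1)%E.
Proof.
have c0 := chi2_const_gt0.
transitivity (\int[mu]_(x in `]0%R, +oo[)
    ((chi2_const * 2 `^ (nu / 2))%:E *
     (expR (- (x / 2)) * (x / 2) `^ (nu / 2 - 1) * 2^-1)%:E))%E.
  apply: eq_integral => x; rewrite inE/= in_itv/= andbT => x0.
  rewrite -EFinM chi2_pdf_posE// -!mulrA mulNr; congr (_ * _)%:E.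
  rewrite [RHS]mulrCA; congr (_ * _).
  rewrite powRM ?ltW// ?invr_gt0//.
  rewrite [2^-1 `^ _](_ : _ = (2 `^ (nu / 2))^-1 * 2); last first.
    rewrite -powR_inv1 // -powRrM mulN1r opprB addrC powRD; last first.
      by apply/implyP => _.
    by rewrite powRN powRr1.
  by field; rewrite gt_eqF// powR_gt0.
rewrite ge0_integralZl//; last 3 first.
- apply/measurable_EFinP/measurable_funTS.
  have mh : measurable_fun [set: R] (fun x : R => x / 2) by exact: measurable_funM.
  have mG := measurableT_comp (@measurable_gamma_integrand R (nu / 2) setT) mh.
  have mGc := measurable_funM mG (@measurable_cst _ _ R R setT 2^-1).
  exact: mGc.
- by move=> x _; rewrite lee_fin mulr_ge0// gamma_integrand_ge0.
- by rewrite lee_fin mulr_ge0 ?powR_ge0 ?(ltW c0).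
have dF (x : R) : 0 < x -> is_derive x 1 (fun x : R => x / 2) 2^-1.
  move=> _; rewrite (_ : (fun x : R => x / 2) = 2^-1 \*: id); last first.
    by apply/funext => y/=; rewrite /GRing.scale/= mulrC.
  rewrite -[X in is_derive _ _ _ X]mulr1; exact: is_deriveZ.
rewrite -(@ge0_integration_by_substitution_oy _ _ (fun=> 2^-1)
  (fun t : R => expR (- t) * t `^ (nu / 2 - 1)) dF).
- rewrite gamma_funE// -EFinM /chi2_const -mulrA mulVf//.
  by rewrite gt_eqF// mulr_gt0 ?powR_gt0 ?gamma_fun_gt0.
- by move=> x _; rewrite invr_gt0.
- by move=> x _; exact: cvg_cst.
- by move=> x x0; rewrite divr_gt0.
- rewrite -[X in _ --> X](mul0r 2^-1); apply: cvgMl; exact: cvg_at_right_filter.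
- apply: gt0_cvgMly => //; rewrite invr_gt0//.
- move=> x x0; apply: cvgM; last exact: continuous_powR_gt0.
  apply: (@continuous_comp _ _ _ (fun x : R => - x) expR); last exact: continuous_expR.
  exact: continuousN.
- by move=> x _; exact: gamma_integrand_ge0.
Qed.

(** The density vanishes on the nonpositive reals. This discards the points [q <= 0] of the set that
    defines [G], where [Num.sqrt (nu / q)] takes the default value 0. *)
Lemma chi2_probI (A : set R) : chi2_prob nu A = chi2_prob nu (A `&` `]0, +oo[).
Proof.
rewrite /chi2_prob [RHS]integral_mkcondr; apply: eq_integral => x _.
rewrite patchE; case: ifPn => //; rewrite notin_setE/= in_itv/= andbT.
by rewrite /chi2_pdf => /negP/negPf ->.
Qed.

Lemma integral_chi2_pdf : (\int[mu]_x (chi2_pdf nu x)%:E = 1)%E.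
Proof.
by have := chi2_probI setT; rewrite setTI /chi2_prob integral_chi2_pdf_pos.
Qed.

Lemma integrable_chi2_pdf : mu.-integrable setT (fun x => (chi2_pdf nu x)%:E).
Proof.
apply/integrableP; split.
  by apply/measurable_EFinP; exact: measurable_chi2_pdf.
under eq_integral do rewrite gee0_abs ?lee_fin ?chi2_pdf_ge0//.
by rewrite integral_chi2_pdf ltry.
Qed.

End chi2.

(** * The chi-square distribution function and Ginv *)

Section chi2_cdf.
Context {R : realType}.
Notation mu := (@lebesgue_measure R).
Variable nu : R.
Hypothesis nu0 : 0 < nu.

Definition chi2_cdf (y : R) : R := \int[mu]_(t in `]-oo, y]) chi2_pdf nu t.

Let nu20 : 0 < nu / 2. Proof. by rewrite divr_gt0. Qed.

Let integrable_chi2 (A : set R) : measurable A ->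
  mu.-integrable A (EFin \o chi2_pdf nu).
Proof.
by move=> mA; apply: integrableS (integrable_chi2_pdf nu0).
Qed.

Lemma chi2_probE (A : set R) : measurable A ->
  chi2_prob nu A = (\int[mu]_(t in A) chi2_pdf nu t)%:E.
Proof.
move=> mA; rewrite /Rintegral fineK//.
exact: integrable_fin_num (integrable_chi2 mA).
Qed.

Lemma chi2_cdfE y : 0 < y ->
  (\int[mu]_(t in `]0%R, y]) (chi2_pdf nu t)%:E = (chi2_cdf y)%:E)%E.
Proof.
move=> y0; rewrite -chi2_probE//= [RHS]chi2_probI.
rewrite /chi2_prob; congr integral; apply/seteqP; split => x/=; rewrite !in_itv/= andbT.
  by move=> /andP[-> ->].
by move=> [-> ->].
Qed.

(** The exponential factor of the density is at most 1 on (0, y]. *)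
Lemma chi2_cdf_le y : 0 < y -> chi2_cdf y <= chi2_const nu * (y `^ (nu / 2) / (nu / 2)).
Proof.
move=> y0; rewrite -lee_fin -chi2_cdfE// EFinM -integral_powR_0y//.
rewrite -ge0_integralZl//=; last 3 first.
- by apply/measurable_EFinP/measurable_funTS; exact: measurable_powR.
- by move=> x _; rewrite lee_fin powR_ge0.
- by rewrite lee_fin ltW// chi2_const_gt0.
apply: ge0_le_integral => //=.
- by move=> x _; rewrite lee_fin chi2_pdf_ge0.
- by apply/measurable_EFinP; exact: measurable_chi2_pdf.
- by apply/measurable_EFinP; exact: measurable_cst_powR.
- move=> x; rewrite in_itv/= => /andP[x0 _]; rewrite lee_fin chi2_pdf_posE//.
  rewrite ler_pM2l ?chi2_const_gt0// ler_piMl ?powR_ge0//.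
  by rewrite -expR0 ler_expR mulNr oppr_le0 divr_ge0// ltW.
Qed.

(** On (0, y] the exponential factor is at least exp (-y/2). This loss relative to [chi2_cdf_le]
    disappears as y tends to 0, so the two bounds determine the behaviour at 0. *)
Lemma chi2_cdf_ge y : 0 < y ->
  expR (- y / 2) * (chi2_const nu * (y `^ (nu / 2) / (nu / 2))) <= chi2_cdf y.
Proof.
move=> y0; rewrite -lee_fin -chi2_cdfE// mulrA EFinM -integral_powR_0y//.
rewrite -ge0_integralZl//=; last 3 first.
- by apply/measurable_EFinP/measurable_funTS; exact: measurable_powR.
- by move=> x _; rewrite lee_fin powR_ge0.
- by rewrite lee_fin mulr_ge0 ?expR_ge0// ltW// chi2_const_gt0.
apply: ge0_le_integral => //=.
- move=> x _; rewrite lee_fin !mulr_ge0 ?expR_ge0 ?powR_ge0//.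
  by rewrite ltW// chi2_const_gt0.
- by apply/measurable_EFinP; exact: measurable_cst_powR.
- by apply/measurable_EFinP; exact: measurable_chi2_pdf.
- move=> x; rewrite in_itv/= => /andP[x0 xy]; rewrite lee_fin chi2_pdf_posE//.
  rewrite -mulrA mulrCA ler_pM2l ?chi2_const_gt0// ler_wpM2r ?powR_ge0//.
  by rewrite ler_expR ler_pM2r ?invr_gt0// lerN2.
Qed.

Lemma chi2_cdf_gt0 y : 0 < y -> 0 < chi2_cdf y.
Proof.
move=> y0; apply: lt_le_trans (chi2_cdf_ge y0).
by rewrite !mulr_gt0 ?expR_gt0 ?chi2_const_gt0 ?powR_gt0 ?invr_gt0.
Qed.

Lemma is_derive_chi2_cdf (y : R) : 0 < y -> is_derive y 1 chi2_cdf (chi2_pdf nu y).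
Proof.
move=> y0; apply: derive_cdf; last exact: continuous_chi2_pdf.
by move=> u; exact: integrable_chi2.
Qed.

Lemma continuous_chi2_cdf (y : R) : 0 < y -> {for y, continuous chi2_cdf}.
Proof.
by move=> /is_derive_chi2_cdf[+ _] => /derivable1_diffP; exact: differentiable_continuous.
Qed.

Lemma chi2_cdf_incr x y : 0 < x -> x < y -> chi2_cdf x < chi2_cdf y.
Proof.
move=> x0 xy.
have x'0 u : u \in `]x, y[ -> 0 < u.
  by rewrite in_itv/= => /andP[+ _]; exact: lt_trans.
apply: (@gtr0_derive1_incr _ chi2_cdf x y) => //.
- by move=> u /x'0 /is_derive_chi2_cdf[].
- move=> u /x'0 u0; rewrite derive1E.
  by have [_ ->] := is_derive_chi2_cdf u0; rewrite chi2_pdf_gt0.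
- apply: continuous_at_within => u/=; rewrite in_itv/= => /andP[xu _].
  by apply: continuous_chi2_cdf; exact: lt_le_trans xu.
Qed.

Lemma chi2_cdf_lt1 y : 0 < y -> chi2_cdf y < 1.
Proof.
move=> y0; apply: (@lt_le_trans _ _ (chi2_cdf (y + 1))).
  by apply: chi2_cdf_incr => //; rewrite ltrDl.
rewrite -lee_fin -chi2_probE// -(integral_chi2_pdf nu0).
apply: ge0_subset_integral => //=.
- by apply/measurable_EFinP; exact: measurable_chi2_pdf.
- by move=> x _; rewrite lee_fin chi2_pdf_ge0.
Qed.

Lemma chi2_cdf_cvg1 : chi2_cdf n%:R @[n --> \oo] --> (1 : R).
Proof.
apply: fine_cvg.
have U : \bigcup_n `]-oo, n%:R]%classic = [set: R].
  apply/seteqP; split => // x _; exists (Num.truncn (Num.max 0 x)).+1 => //=.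
  rewrite in_itv/=.
  have /andP[_ h] : (Num.truncn (Num.max 0 x))%:R <= Num.max 0 x
     < (Num.truncn (Num.max 0 x)).+1%:R.
    by apply: truncn_itv; rewrite le_max lexx.
  by apply: le_trans (ltW h); rewrite le_max lexx orbT.
rewrite -(integral_chi2_pdf nu0) -U.
apply: ge0_nondecreasing_set_cvg_integral.
- move=> m n mn; rewrite subsetEset; apply: subset_itvl; rewrite bnd_simp.
  by rewrite ler_nat.
- by move=> n; exact: measurable_itv.
- by move=> n; apply/measurable_EFinP; exact: measurable_chi2_pdf.
- by move=> n x _; rewrite lee_fin chi2_pdf_ge0.
Qed.

Lemma chi2_cdf_surj s : 0 < s < 1 -> exists2 y, 0 < y & chi2_cdf y = s.
Proof.
move=> /andP[s0 s1].
have k0 := chi2_const_gt0 nu0.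
(* [a] is the point where the upper bound of [chi2_cdf_le] equals [s], so it can serve as left end
   for the intermediate value theorem. *)
pose b := s * (nu / 2) / chi2_const nu.
have b0 : 0 < b by rewrite divr_gt0// mulr_gt0.
pose a := b `^ (nu / 2)^-1.
have a0 : 0 < a by rewrite powR_gt0.
have Fa : chi2_cdf a <= s.
  apply: (le_trans (chi2_cdf_le a0)); rewrite le_eqVlt; apply/orP; left; apply/eqP.
  rewrite /a -powRrM mulVf ?gt_eqF// powRr1 ?ltW// /b.
  by field; rewrite !gt_eqF.
have := chi2_cdf_cvg1 => /cvgr_gt /(_ _ s1)[N _ hN].
pose n := maxn N (Num.truncn a).+1.
have Fn : s < chi2_cdf n%:R by apply: hN => /=; rewrite leq_maxl.
have an : a <= n%:R.
  have /andP[_ h] : (Num.truncn a)%:R <= a < (Num.truncn a).+1%:R.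
    by apply: truncn_itv; exact: ltW.
  by apply: (le_trans (ltW h)); rewrite ler_nat leq_maxr.
have [||c] := @IVT _ chi2_cdf a n%:R s an.
- apply: continuous_at_within => u/=; rewrite in_itv/= => /andP[xu _].
  by apply: continuous_chi2_cdf; exact: lt_le_trans xu.
- by rewrite ge_min Fa/= le_max (ltW Fn) orbT.
- by rewrite in_itv/= => /andP[ac _] <-; exists c => //; exact: lt_le_trans ac.
Qed.

Lemma chi2_cdf_le0 y : y <= 0 -> chi2_cdf y = 0.
Proof.
move=> y0; rewrite /chi2_cdf /Rintegral.
have := chi2_probI nu `]-oo, y].
rewrite (_ : _ `&` _ = set0) /chi2_prob; last first.
  apply/seteqP; split => // x/=; rewrite !in_itv/= andbT => -[xy].
  by move=> /lt_le_trans /(_ (le_trans xy y0)); rewrite ltxx.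
by rewrite integral_set0 => ->.
Qed.

Lemma chi2_cdf_ge0 y : 0 <= chi2_cdf y.
Proof. by apply: Rintegral_ge0 => x _; exact: chi2_pdf_ge0. Qed.

Lemma chi2_cdf_nd : {homo chi2_cdf : x y / x <= y}.
Proof.
move=> x y; have [x0 _|x0] := leP x 0; first by rewrite chi2_cdf_le0 ?chi2_cdf_ge0.
by rewrite le_eqVlt => /predU1P[->//|xy]; exact/ltW/chi2_cdf_incr.
Qed.

Lemma measurable_chi2_cdf (A : set R) : measurable A -> measurable_fun A chi2_cdf.
Proof. by move=> mA; apply: nondecreasing_measurable => //; exact: chi2_cdf_nd. Qed.

(** For q > 0, sqrt (nu/q) <= w means q >= nu/w^2; the rest is the complement in a law of total mass
    1 without atoms. *)
Lemma G_chi2 w : 0 < w -> G nu w = 1 - chi2_cdf (nu / w ^+ 2).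
Proof.
move=> w0; pose y := nu / w ^+ 2.
have y0 : 0 < y by rewrite divr_gt0// exprn_gt0.
have E : [set q : R | Num.sqrt (nu / q) <= w] `&` `]0, +oo[ = `[y, +oo[%classic.
  apply/seteqP; split => q/=; rewrite !in_itv/= !andbT.
    move=> [+ q0]; rewrite -ler_sqr ?nnegrE ?sqrtr_ge0 ?(ltW w0)//.
    rewrite sqr_sqrtr; last by rewrite divr_ge0// ltW.
    by rewrite ler_pdivrMr// /y ler_pdivrMr ?exprn_gt0// mulrC.
  move=> yq; have q0 : 0 < q by exact: lt_le_trans yq.
  split => //; rewrite -ler_sqr ?nnegrE ?sqrtr_ge0 ?(ltW w0)//.
  rewrite sqr_sqrtr; last by rewrite divr_ge0// ltW.
  by rewrite ler_pdivrMr// mulrC -ler_pdivrMr ?exprn_gt0.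
rewrite /G chi2_probI E chi2_probE//=; apply/eqP; rewrite eq_sym subr_eq; apply/eqP.
rewrite -(Rintegral_itv_obnd_cbnd (integrable_chi2 _))// addrC.
rewrite /chi2_cdf -Rintegral_setU//.
- rewrite -itv_bndbnd_setU// set_itvE /Rintegral.
  by rewrite integral_chi2_pdf.
- by apply: integrable_chi2; exact: measurableU.
- apply/disj_setPS => x/= [] /=; rewrite !in_itv/= andbT => h1.
  by move=> /(le_lt_trans h1); rewrite ltxx.
Qed.

Lemma G_lt v w : 0 < v -> v < w -> G nu v < G nu w.
Proof.
move=> v0 vw; have w0 := lt_trans v0 vw.
rewrite !G_chi2// ltrD2l ltrN2; apply: chi2_cdf_incr.
  by rewrite divr_gt0// exprn_gt0.
by rewrite ltr_pM2l// ltf_pV2 ?posrE ?exprn_gt0// ltr_pXn2r// nnegrE ltW.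
Qed.

Lemma G_itv w : 0 < w -> 0 < G nu w < 1.
Proof.
move=> w0; have y0 : 0 < nu / w ^+ 2 by rewrite divr_gt0// exprn_gt0.
by rewrite G_chi2// subr_gt0 chi2_cdf_lt1//= ltrBlDr ltrDl chi2_cdf_gt0.
Qed.

Lemma G_surj s : 0 < s < 1 -> exists2 w, 0 < w & G nu w = s.
Proof.
move=> /andP[s0 s1].
have /chi2_cdf_surj[y y0 yE] : 0 < 1 - s < 1 by rewrite subr_gt0 s1 ltrBlDr ltrDl.
have w0 : 0 < Num.sqrt (nu / y) by rewrite sqrtr_gt0 divr_gt0.
exists (Num.sqrt (nu / y)) => //; rewrite G_chi2// sqr_sqrtr ?divr_ge0 ?ltW//.
by rewrite invf_div mulrCA divff ?gt_eqF// mulr1 yE opprB addrC subrK.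
Qed.

Lemma G_image : G nu @` `]0, +oo[ = `]0, 1[%classic.
Proof.
apply/seteqP; split => [s [w]|s]/=; rewrite !in_itv/= ?andbT.
  by move=> w0 <-; exact: G_itv.
by move=> /G_surj[w w0 <-]; exists w => //; rewrite in_itv/= w0.
Qed.

Lemma Ginv_in s : 0 < s < 1 -> 0 < Ginv nu s /\ G nu (Ginv nu s) = s.
Proof.
move=> s01; have sG : (G nu @` `]0, +oo[) s by rewrite G_image/= in_itv/=.
split; last by rewrite /Ginv pinvK// inE.
rewrite /Ginv /pinv_ splitV oinv_surj; case: pselect => //= h.
by case: cid2 => w /=; rewrite in_itv/= andbT.
Qed.

(** Such an [s] has no preimage in the positive reals, so the partial inverse returns its default,
    the constant 0. *)
Lemma Ginv_out s : ~ (0 < s < 1) -> Ginv nu s = 0.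
Proof.
move=> s01; rewrite /Ginv /pinv_ splitV oinv_surj; case: pselect => //= h.
have h2 : (G nu @` `]0, +oo[) s by exact: h.
by exfalso; apply: s01; move: h2; rewrite G_image/= in_itv/=.
Qed.

(** As [Ginv nu s >= 0], a product at most x < 0 forces z < 0; dividing by z reverses the inequality
    and [G] is increasing. For [s] outside (0, 1) the product is 0, so the equivalence holds for
    every value of S and not only almost surely. *)
Lemma Ginv_mul_le x s z : x < 0 ->
  (Ginv nu s * z <= x) = [&& 0 < s < 1, z < 0 & G nu (x / z) <= s].
Proof.
move=> x0; apply/idP/idP => [|/and3P[s01 z0]].
  have [s01|/negP s01] := boolP (0 < s < 1); last first.
    by rewrite Ginv_out// mul0r leNgt x0.
  have [w0 wE] := Ginv_in s01; set w := Ginv nu s in w0 wE *.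
  move=> wz; have z0 : z < 0.
    rewrite ltNge; apply/negP => z0.
    by have := lt_le_trans x0 (mulr_ge0 (ltW w0) z0); rewrite ltNge wz.
  rewrite z0/= -wE; have : x / z <= w by rewrite ler_ndivrMr.
  rewrite le_eqVlt => /predU1P[->//|xw].
  by apply/ltW/G_lt => //; rewrite nmulr_rgt0// invr_lt0.
have [w0 wE] := Ginv_in s01; set w := Ginv nu s in w0 wE *.
rewrite -[in X in X -> _]wE -ler_ndivrMr// => h; rewrite leNgt; apply/negP.
by move=> /(G_lt w0); rewrite ltNge h.
Qed.

End chi2_cdf.

(** * The Student distribution *)

Section student.
Context {R : realType}.
Notation mu := (@lebesgue_measure R).
Variable nu : R.
Hypothesis nu0 : 0 < nu.

Let p := (nu + 1) / 2.
Let p0 : 0 < p. Proof. by rewrite divr_gt0// addr_gt0. Qed.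

Definition student_const :=
  gamma_fun ((nu + 1) / 2) / (Num.sqrt (nu * pi) * gamma_fun (nu / 2)).

Lemma student_const_gt0 : 0 < student_const.
Proof.
have nu20 : 0 < nu / 2 by rewrite divr_gt0.
have nupi : 0 < nu * pi by rewrite mulr_gt0 ?pi_gt0.
rewrite divr_gt0 ?gamma_fun_gt0//.
by rewrite mulr_gt0 ?gamma_fun_gt0// sqrtr_gt0.
Qed.

Let base_gt0 (x : R) : 0 < 1 + x ^+ 2 / nu.
Proof. by rewrite ltr_pwDl// divr_ge0 ?sqr_ge0// ltW. Qed.

Lemma student_pdfE x : student_pdf nu x = student_const * (1 + x ^+ 2 / nu) `^ (- p).
Proof. by []. Qed.

Lemma student_pdf_gt0 x : 0 < student_pdf nu x.
Proof. by rewrite mulr_gt0 ?student_const_gt0// powR_gt0. Qed.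

Lemma student_pdfN x : student_pdf nu (- x) = student_pdf nu x.
Proof. by rewrite /student_pdf sqrrN. Qed.

Lemma continuous_student_pdf : continuous (student_pdf nu).
Proof.
move=> x; apply: cvgM; first exact: cvg_cst.
apply: (@continuous_comp _ _ _ (fun x : R => 1 + x ^+ 2 / nu) (fun t : R => t `^ (- p))).
  apply: cvgD; first exact: cvg_cst.
  by apply: cvgMl; exact: exprn_continuous.
exact: continuous_powR_gt0.
Qed.

Lemma measurable_student_pdf (A : set R) : measurable A ->
  measurable_fun A (student_pdf nu).
Proof.
by move=> mA; apply: continuous_at_measurable => // x _; exact: continuous_student_pdf.
Qed.

Let powR_base y : 0 < y -> nu `^ p * y `^ (- nu - 1) = (y ^+ 2 / nu) `^ (- p).
Proof.
move=> y0; rewrite powRM ?sqr_ge0 ?invr_ge0 ?(ltW nu0)// mulrC; congr (_ * _).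
  rewrite -(powR_mulrn 2 (ltW y0)) -powRrM; congr (_ `^ _).
  by rewrite /p; field.
by rewrite -(powR_inv1 (ltW nu0)) -powRrM mulrNN mul1r.
Qed.

(** The 1 in the base 1 + y^2/nu is dropped; the exponent being negative, this enlarges the density
    to a pure power. *)
Lemma student_pdf_le y : 0 < y ->
  student_pdf nu y <= student_const * nu `^ p * y `^ (- nu - 1).
Proof.
move=> y0; rewrite student_pdfE -mulrA ler_pM2l ?student_const_gt0//.
rewrite powR_base//.
rewrite !powRN lef_pV2 ?posrE ?powR_gt0// ?divr_gt0 ?exprn_gt0//.
rewrite ge0_ler_powR ?nnegrE ?(ltW p0) ?(ltW (base_gt0 _))//.
  by rewrite divr_ge0 ?sqr_ge0// ltW.
by rewrite lerDr.
Qed.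

(** For y >= x one has 1 <= y^2/x^2 = (nu/x^2)(y^2/nu), so the base is at most (1 + nu/x^2)(y^2/nu).
    The correction depends on the end point x only, hence comes out of the tail integral. *)
Lemma student_pdf_ge x y : 0 < x -> x <= y ->
  (1 + nu / x ^+ 2) `^ (- p) * (student_const * nu `^ p) * y `^ (- nu - 1) <=
  student_pdf nu y.
Proof.
move=> x0 xy; have y0 := lt_le_trans x0 xy.
rewrite student_pdfE -mulrA -[_ * _ * y `^ _]mulrA mulrCA ler_pM2l ?student_const_gt0//.
rewrite powR_base//.
have b0 : 0 < 1 + nu / x ^+ 2 by rewrite ltr_pwDl// divr_ge0 ?sqr_ge0// ltW.
have c0 : 0 < y ^+ 2 / nu by rewrite divr_gt0 ?exprn_gt0.
have key : 1 + y ^+ 2 / nu <= (1 + nu / x ^+ 2) * (y ^+ 2 / nu).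
  rewrite mulrDl mul1r addrC lerD2l.
  rewrite (_ : nu / x ^+ 2 * _ = y ^+ 2 / x ^+ 2); last first.
    by field; rewrite !gt_eqF.
  rewrite ler_pdivlMr ?exprn_gt0// mul1r.
  by rewrite ler_pXn2r// nnegrE ltW.
rewrite -powRM ?(ltW b0) ?(ltW c0)// !powRN lef_pV2 ?posrE ?powR_gt0// ?mulr_gt0 ?invr_gt0//.
by apply: ge0_ler_powR => //; rewrite ?nnegrE ltW// mulr_gt0.
Qed.

(* [student_cdf nu x] is equivalent to [student_coef * (- x) `^ (- nu)] at -oo. *)
Definition student_coef := student_const * nu `^ p / nu.

Lemma student_coef_gt0 : 0 < student_coef.
Proof. by rewrite divr_gt0// mulr_gt0 ?student_const_gt0 ?powR_gt0. Qed.

Let integral_cst_tail k x : 0 < k -> 0 < x ->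
  (\int[mu]_(t in `[x, +oo[) (k * t `^ (- nu - 1))%:E = (k / nu * x `^ (- nu))%:E)%E.
Proof.
move=> k0 x0; under eq_integral do rewrite EFinM.
rewrite ge0_integralZl//=; last 3 first.
- by apply/measurable_EFinP/measurable_funTS; exact: measurable_powR.
- by move=> y _; rewrite lee_fin powR_ge0.
- by rewrite lee_fin ltW.
by rewrite integral_powR_tail// -EFinM; congr EFin; ring.
Qed.

Lemma integral_student_le x : 0 < x ->
  (\int[mu]_(t in `[x, +oo[) (student_pdf nu t)%:E <=
   (student_coef * x `^ (- nu))%:E)%E.
Proof.
move=> x0.
have K0 : 0 < student_const * nu `^ p.
  by apply: mulr_gt0; [exact: student_const_gt0|exact: powR_gt0].
rewrite /student_coef -(integral_cst_tail K0 x0).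
apply: ge0_le_integral => //=.
- by move=> t _; rewrite lee_fin ltW// student_pdf_gt0.
- by apply/measurable_EFinP; exact: measurable_student_pdf.
- by apply/measurable_EFinP; exact: measurable_cst_powR.
- move=> t; rewrite in_itv/= andbT => xt; rewrite lee_fin.
  by apply: student_pdf_le; exact: lt_le_trans xt.
Qed.

Lemma integral_student_ge x : 0 < x ->
  (((1 + nu / x ^+ 2) `^ (- p) * student_coef * x `^ (- nu))%:E <=
  \int[mu]_(t in `[x, +oo[) (student_pdf nu t)%:E)%E.
Proof.
move=> x0.
have b0 : 0 < 1 + nu / x ^+ 2 by rewrite ltr_pwDl// divr_ge0 ?sqr_ge0// ltW.
have K0 : 0 < (1 + nu / x ^+ 2) `^ (- p) * (student_const * nu `^ p).
  apply: mulr_gt0; first exact: powR_gt0.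
  by apply: mulr_gt0; [exact: student_const_gt0|exact: powR_gt0].
rewrite /student_coef mulrA -(integral_cst_tail K0 x0).
apply: ge0_le_integral => //=.
- move=> t _; rewrite lee_fin; apply: mulr_ge0; last exact: powR_ge0.
  apply: mulr_ge0; first exact: powR_ge0.
  by apply: mulr_ge0; [exact: ltW student_const_gt0|exact: powR_ge0].
- by apply/measurable_EFinP; exact: measurable_cst_powR.
- by apply/measurable_EFinP; exact: measurable_student_pdf.
- move=> t; rewrite in_itv/= andbT => xt; rewrite lee_fin.
  exact: student_pdf_ge.
Qed.

Lemma integral_student_opp x :
  (\int[mu]_(t in `]-oo, (- x)%R]) (student_pdf nu t)%:E =
   \int[mu]_(t in `[x, +oo[) (student_pdf nu t)%:E)%E.
Proof.
rewrite ge0_integration_by_substitutionNy.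
- by apply: eq_integral => t _ /=; rewrite student_pdfN.
- by apply: continuous_at_within => t _; exact: continuous_student_pdf.
- by move=> t _; rewrite ltW// student_pdf_gt0.
Qed.

Lemma integrable_student_pdf u : mu.-integrable `]-oo, u] (EFin \o student_pdf nu).
Proof.
(* Enlarging the half-line puts -1 inside it: the part below -1 is a power tail, the rest is bounded
   on a bounded interval. *)
pose M := Num.max u 0.
suff I : mu.-integrable `]-oo, M] (EFin \o student_pdf nu).
  by apply: integrableS I => //; apply: subset_itvl; rewrite bnd_simp le_max lexx.
apply/integrableP; split.
  by apply/measurable_EFinP; exact: measurable_student_pdf.
under eq_integral do rewrite /= ger0_norm ?(ltW (student_pdf_gt0 _))//.
have M1 : -1 < M by rewrite lt_max ltrN10 orbT.
rewrite (@itv_bndbnd_setU _ _ -oo%O (BRight (-1)) (BRight M))//; last first.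
  by rewrite bnd_simp ltW.
rewrite ge0_integral_setU//=; last 3 first.
- by apply/measurable_EFinP; apply: measurable_student_pdf; exact: measurableU.
- by move=> x _; rewrite lee_fin ltW// student_pdf_gt0.
- apply/disj_setPS => x/= [] /=; rewrite !in_itv/= => h1 /andP[h2 _].
  by have := lt_le_trans h2 h1; rewrite ltxx.
apply: lte_add_pinfty.
  rewrite integral_student_opp; apply: le_lt_trans (integral_student_le _) _ => //.
  exact: ltry.
apply: (@le_lt_trans _ _ (\int[mu]_(x in `](-1)%R, M]) (student_const%:E))%E).
  apply: ge0_le_integral => //=.
  - by move=> t _; rewrite lee_fin ltW// student_pdf_gt0.
  - by apply/measurable_EFinP; exact: measurable_student_pdf.
  - move=> t _; rewrite lee_fin student_pdfE ler_piMr ?(ltW student_const_gt0)//.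
    rewrite powRN invf_le1 ?powR_gt0//.
    have h : 1 <= 1 + t ^+ 2 / nu by rewrite lerDl divr_ge0 ?sqr_ge0// ltW.
    have := @ge0_ler_powR _ p (ltW p0) 1 (1 + t ^+ 2 / nu).
    rewrite powR1; apply => //; rewrite nnegrE ltW//.
by rewrite integral_cst//= lebesgue_measure_itv/= lte_fin M1 -EFinB -EFinM ltry.
Qed.

Lemma student_cdf_tailE x :
  (\int[mu]_(t in `[x, +oo[) (student_pdf nu t)%:E = (student_cdf nu (- x))%:E)%E.
Proof.
rewrite -integral_student_opp /student_cdf /Rintegral fineK//.
exact: integrable_fin_num (integrable_student_pdf (- x)).
Qed.

Lemma student_cdf_le x : x < 0 -> student_cdf nu x <= student_coef * (- x) `^ (- nu).
Proof.
move=> x0; rewrite -{1}(opprK x) -lee_fin -student_cdf_tailE integral_student_le//.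
by rewrite oppr_gt0.
Qed.

Lemma student_cdf_ge x : x < 0 ->
  (1 + nu / x ^+ 2) `^ (- p) * student_coef * (- x) `^ (- nu) <= student_cdf nu x.
Proof.
move=> x0; rewrite -{3}(opprK x) -lee_fin -student_cdf_tailE -(sqrrN x).
by apply: integral_student_ge; rewrite oppr_gt0.
Qed.

Lemma is_derive_student_cdf (x : R) :
  is_derive x 1 (student_cdf nu) (student_pdf nu x).
Proof.
by apply: derive_cdf; [exact: integrable_student_pdf|exact: continuous_student_pdf].
Qed.

Lemma continuous_student_cdf : continuous (student_cdf nu).
Proof.
move=> x; have [+ _] := is_derive_student_cdf x.
by move=> /derivable1_diffP; exact: differentiable_continuous.
Qed.

Lemma student_cdf_incr : {mono student_cdf nu : x y / x <= y}.
Proof.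
apply: le_mono => x y xy.
apply: (@gtr0_derive1_incr _ (student_cdf nu) x y) => //.
- by move=> u _; have [] := is_derive_student_cdf u.
- move=> u _; rewrite derive1E.
  by have [_ ->] := is_derive_student_cdf u; rewrite student_pdf_gt0.
- by apply: continuous_at_within => u _; exact: continuous_student_cdf.
Qed.

(** The lower tail bound at the negative point [Num.min x (-1)] is already positive. *)
Lemma student_cdf_gt0 x : 0 < student_cdf nu x.
Proof.
have m1 : Num.min x (-1) < 0 by rewrite gt_min ltrN10 orbT.
have b0 : 0 < 1 + nu / (Num.min x (-1)) ^+ 2.
  by rewrite ltr_pwDl// divr_ge0 ?sqr_ge0// ltW.
apply: (@lt_le_trans _ _ (student_cdf nu (Num.min x (-1)))); last first.
  by rewrite student_cdf_incr ge_min lexx.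
apply: lt_le_trans (student_cdf_ge m1).
apply: mulr_gt0; last by rewrite powR_gt0// oppr_gt0.
by apply: mulr_gt0; [exact: powR_gt0|exact: student_coef_gt0].
Qed.

(** The requirement [x <= -1] is what later bounds 1 + nu/x^2 by 1 + nu, uniformly along a sequence
    of quantiles. *)
Lemma student_quantile q : 0 < q < student_cdf nu (-1) ->
  exists2 x, x <= -1 & student_cdf nu x = q.
Proof.
move=> /andP[q0 q1].
have c0 := student_coef_gt0.
pose b := q / student_coef.
have b0 : 0 < b by rewrite divr_gt0.
pose a := - b `^ (- nu)^-1.
have a0 : a < 0 by rewrite oppr_lt0 powR_gt0.
have Fa : student_cdf nu a <= q.
  apply: (le_trans (student_cdf_le a0)).
  rewrite le_eqVlt; apply/orP; left; apply/eqP.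
  rewrite /a opprK -powRrM mulVf ?oppr_eq0 ?gt_eqF// powRr1 ?ltW // /b.
  by field; rewrite gt_eqF.
have a1 : a <= -1.
  by rewrite -student_cdf_incr (le_trans Fa)// ltW.
have [||c] := @IVT _ (student_cdf nu) a (-1) q a1.
- by apply: continuous_at_within => u _; exact: continuous_student_cdf.
- by rewrite ge_min Fa/= le_max (ltW q1) orbT.
- by rewrite in_itv/= => /andP[_ c1] <-; exists c.
Qed.

End student.

(** * Comparison of the chi-square and Student tails *)

Section tails.
Context {R : realType}.
Variable nu : R.
Hypothesis nu0 : 0 < nu.

(* The nu-th moment of the negative part of a standard normal variable, see
   [half_normal_moment]. *)
Definition tail_coef : R :=
  2 `^ (nu / 2 - 1) * gamma_fun ((1 + nu) / 2) / Num.sqrt pi.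

Lemma tail_coef_gt0 : 0 < tail_coef.
Proof.
apply: divr_gt0; last by rewrite sqrtr_gt0 pi_gt0.
apply: mulr_gt0; first exact: powR_gt0.
by rewrite gamma_fun_gt0// divr_gt0// addr_gt0.
Qed.

(* [chi2_cdf nu (nu / w ^+ 2)] is equivalent to [chi2_coef * w `^ (- nu)] at +oo. *)
Definition chi2_coef : R := chi2_const nu * (nu `^ (nu / 2) / (nu / 2)).

Lemma chi2_coef_gt0 : 0 < chi2_coef.
Proof.
apply: mulr_gt0; first exact: chi2_const_gt0.
by rewrite divr_gt0 ?powR_gt0// divr_gt0.
Qed.

(** In probabilistic terms: P(W Z <= x) behaves like E[|Z|^nu ; Z < 0] times the tail of W at |x|,
    and W Z is Student. The proof compares the closed forms, where the powers of nu cancel. *)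
Lemma tail_coefE : student_coef nu / chi2_coef = tail_coef.
Proof.
have nu20 : 0 < nu / 2 by rewrite divr_gt0.
have nu120 : 0 < (nu + 1) / 2 by rewrite divr_gt0// addr_gt0.
have g1 := gamma_fun_gt0 nu20; have g2 := gamma_fun_gt0 nu120.
rewrite /student_coef /student_const /chi2_coef /chi2_const /tail_coef [1 + nu]addrC.
set g := gamma_fun _ in g1 *; set h := gamma_fun _ in g2 *.
have -> : nu `^ ((nu + 1) / 2) = nu `^ (nu / 2) * Num.sqrt nu.
  rewrite -powR12_sqrt ?ltW// -powRD; last by rewrite (gt_eqF nu0) implybT.
  by congr (_ `^ _); rewrite mulrDl mul1r.
have -> : 2 `^ (nu / 2 - 1) = 2 `^ (nu / 2) / 2 :> R.
  by rewrite powRB ?powRr1// pnatr_eq0 implybT.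
rewrite sqrtrM ?ltW//.
have a1 : 0 < nu `^ (nu / 2) by rewrite powR_gt0.
have a2 : 0 < (2 : R) `^ (nu / 2) by rewrite powR_gt0.
have a3 : 0 < Num.sqrt nu by rewrite sqrtr_gt0.
have a4 : 0 < Num.sqrt pi :> R by rewrite sqrtr_gt0 pi_gt0.
by field; rewrite !gt_eqF.
Qed.

Variables (q x : R^nat).
Hypotheses (x_le : forall n, x n <= -1) (xq : forall n, student_cdf nu (x n) = q n).
Hypothesis (q_cvg0 : q n @[n --> \oo] --> (0 : R)).

Let c := student_coef nu.
Let c0 : 0 < c. Proof. exact: student_coef_gt0. Qed.
Let p := (nu + 1) / 2.
Let x0 n : x n < 0. Proof. by rewrite (le_lt_trans (x_le n))// ltrN10. Qed.
Let Nx0 n : 0 < - x n. Proof. by rewrite oppr_gt0. Qed.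
Let q0 n : 0 < q n. Proof. by rewrite -xq student_cdf_gt0. Qed.
(** The normalised level, which tends to [c]. Its lower bound [c'] below comes from [x n ^+ 2 >= 1]
    and is uniform in [n]. *)
Let r n := q n * (- x n) `^ nu.
Let c' := (1 + nu) `^ (- p) * c.
Let c'0 : 0 < c'. Proof. by apply: mulr_gt0 => //; rewrite powR_gt0// addr_gt0. Qed.

Let r_le n : r n <= c.
Proof.
have := student_cdf_le nu0 (x0 n); rewrite xq powRN.
by rewrite ler_pdivlMr ?powR_gt0.
Qed.

Let r_ge n : (1 + nu / x n ^+ 2) `^ (- p) * c <= r n.
Proof.
have := student_cdf_ge nu0 (x0 n); rewrite xq [(- x n) `^ _]powRN.
by rewrite ler_pdivrMr ?powR_gt0.
Qed.

Let r_ge' n : c' <= r n.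
Proof.
apply: le_trans (r_ge n); rewrite ler_pM2r//.
have h1 : 0 < x n ^+ 2 by rewrite exprn_even_gt0//= lt_eqF.
have h2 : 0 < 1 + nu / x n ^+ 2 by rewrite ltr_pwDl// divr_ge0// ltW.
rewrite !powRN lef_pV2 ?posrE ?powR_gt0 ?addr_gt0 ?divr_gt0//.
apply: ge0_ler_powR; rewrite ?nnegrE.
- by rewrite divr_ge0// addr_ge0// ltW.
- exact: ltW.
- by rewrite addr_ge0// ltW.
- rewrite lerD2l ler_piMr ?(ltW nu0)// invf_le1//.
  by rewrite -sqrrN exprn_ege1// lerNr.
Qed.

Let r_gt0 n : 0 < r n. Proof. exact: lt_le_trans (r_ge' n). Qed.

(** [r n >= c'] bounds this power by [q n / c']. This is how divergence of the quantiles to -oo is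
    recorded. *)
Let cvg_powN : (- x n) `^ (- nu) @[n --> \oo] --> (0 : R).
Proof.
have h : q n / c' @[n --> \oo] --> (0 : R).
  by rewrite -[X in _ --> X](mul0r c'^-1); exact: cvgMl.
apply: (squeeze_cvgr _ (cvg_cst 0) h).
near=> n; rewrite powR_ge0/= ler_pdivlMr// powRN ler_pdivrMl ?powR_gt0// mulrC.
exact: r_ge'.
Unshelve. all: by end_near. Qed.

Let cvg_sqr : (x n ^+ 2)^-1 @[n --> \oo] --> (0 : R).
Proof.
have -> : (fun n => (x n ^+ 2)^-1) = (fun n => ((- x n) `^ (- nu)) `^ (2 / nu)).
  apply/funext => n; rewrite -powRrM (_ : - nu * (2 / nu) = - 2%:R); last first.
    by field; rewrite gt_eqF.
  by rewrite powR_invn ?(ltW (Nx0 n))// sqrrN.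
have nu2 : 0 < 2 / nu by rewrite divr_gt0.
have /cvg_at_rightP := powR_cvg0 nu2; apply; split; last exact: cvg_powN.
by move=> n; rewrite powR_gt0.
Qed.

Let cvg_r : r n @[n --> \oo] --> c.
Proof.
have h : (1 + nu / x n ^+ 2) `^ (- p) * c @[n --> \oo] --> c.
  rewrite -[X in _ --> X](mul1r c); apply: cvgMl.
  have h : 1 + nu / x n ^+ 2 @[n --> \oo] --> (1 : R).
    rewrite -[X in _ --> X]addr0 -[X in _ --> _ + X](mulr0 nu).
    by apply: cvgD; [exact: cvg_cst|apply: cvgM; [exact: cvg_cst|exact: cvg_sqr]].
  have := continuous_cvg _ (@continuous_powR_gt0 R (- p) 1 ltr01) h.
  by rewrite powR1 => hh; exact: hh.
apply: (squeeze_cvgr _ h (cvg_cst c)).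
by near=> n; rewrite r_ge r_le.
Unshelve. all: by end_near. Qed.

Let arg n z := nu / (x n / z) ^+ 2.

Let arg_gt0 n z : z < 0 -> 0 < arg n z.
Proof.
move=> z0; rewrite /arg divr_gt0// exprn_even_gt0//=.
by rewrite mulf_neq0 ?invr_eq0 ?lt_eqF.
Qed.

(** The chi-square upper bound divided by [q n]: the quantile enters only through [r n], so both the
    limit and a uniform bound follow from those of [r]. *)
Let argE n z : z < 0 ->
  chi2_const nu * (arg n z `^ (nu / 2) / (nu / 2)) / q n =
  chi2_coef * (- z) `^ nu / r n.
Proof.
move=> z0.
have Nz0 : 0 < - z by rewrite oppr_gt0.
have -> : arg n z `^ (nu / 2) = nu `^ (nu / 2) * ((- z) `^ nu / (- x n) `^ nu).
  have -> : arg n z = nu * (- z / - x n) ^+ 2.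
    rewrite /arg invrN mulrNN; field.
    by rewrite !lt_eqF.
  rewrite powRM ?sqr_ge0 ?(ltW nu0)//; congr (_ * _).
  rewrite -(powR_mulrn 2) ?divr_ge0 ?(ltW Nz0) ?(ltW (Nx0 n))// -powRrM.
  have -> : 2%:R * (nu / 2) = nu by field.
  rewrite powRM ?invr_ge0 ?(ltW Nz0) ?(ltW (Nx0 n))//.
  by rewrite -(powR_inv1 (ltW (Nx0 n))) -powRrM mulN1r powRN.
have a1 : (- x n) `^ nu != 0 by rewrite gt_eqF// powR_gt0.
have a2 : q n != 0 by rewrite gt_eqF.
rewrite /chi2_coef /r; field.
by rewrite a1 a2 gt_eqF.
Qed.

(** Squeeze: the upper bound converges because [r n] tends to [student_coef], and the lower one
    differs by an exponential factor whose argument tends to 0. *)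
Lemma chi2_tail_cvg z : z < 0 ->
  chi2_cdf nu (nu / (x n / z) ^+ 2) / q n @[n --> \oo] --> (- z) `^ nu / tail_coef.
Proof.
move=> z0.
have U : chi2_coef * (- z) `^ nu / r n @[n --> \oo] --> (- z) `^ nu / tail_coef.
  rewrite -tail_coefE invf_div mulrCA mulrA.
  apply: cvgM; first exact: cvg_cst.
  by apply: cvgV => //; rewrite gt_eqF.
have L : expR (- arg n z / 2) * (chi2_coef * (- z) `^ nu / r n) @[n --> \oo] -->
    (- z) `^ nu / tail_coef.
  rewrite -[X in _ --> X]mul1r; apply: cvgM => //.
  have h0 : arg n z @[n --> \oo] --> (0 : R).
    have -> : (fun n => arg n z) = (fun n => nu * z ^+ 2 * (x n ^+ 2)^-1).
      by apply/funext => n; rewrite /arg expr_div_n invf_div mulrA.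
    rewrite -[X in _ --> X](mulr0 (nu * z ^+ 2)).
    by apply: cvgM; [exact: cvg_cst|exact: cvg_sqr].
  have h : - arg n z / 2 @[n --> \oo] --> (0 : R).
    rewrite -[X in _ --> X](mul0r 2^-1); apply: cvgMl.
    by rewrite -[X in _ --> X]oppr0; exact: cvgN.
  by have := continuous_cvg _ (@continuous_expR R 0) h; rewrite expR0 => hh; exact: hh.
apply: (squeeze_cvgr _ L U); near=> n; rewrite -argE// mulrA.
rewrite !ler_pM2r ?invr_gt0//.
by rewrite chi2_cdf_ge ?chi2_cdf_le// ?arg_gt0.
Unshelve. all: by end_near. Qed.

Lemma chi2_tail_le n z : z < 0 ->
  chi2_cdf nu (nu / (x n / z) ^+ 2) / q n <= chi2_coef / c' * (- z) `^ nu.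
Proof.
move=> z0; have Nz0 : 0 < - z by rewrite oppr_gt0.
apply: (@le_trans _ _ (chi2_coef * (- z) `^ nu / r n)).
  by rewrite -argE// ler_pM2r ?invr_gt0// chi2_cdf_le// arg_gt0.
have K0 : 0 < chi2_coef * (- z) `^ nu.
  by apply: mulr_gt0; [exact: chi2_coef_gt0|exact: powR_gt0].
by rewrite [leRHS]mulrAC ler_pM2l// lef_pV2 ?posrE.
Qed.

End tails.

(** The form used for domination: one constant for all [n] and [z], its explicit value hidden. *)
Lemma chi2_tail_bound {R : realType} (nu : R) (q x : R^nat) : 0 < nu ->
  (forall n, x n <= -1) -> (forall n, student_cdf nu (x n) = q n) ->
  exists2 C, 0 <= C & forall n z, z < 0 ->
    chi2_cdf nu (nu / (x n / z) ^+ 2) / q n <= C * (- z) `^ nu.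
Proof.
move=> nu0 x_le xq; eexists; last by move=> n z; exact: chi2_tail_le.
apply: divr_ge0; first exact/ltW/chi2_coef_gt0.
by apply: mulr_ge0; [exact: powR_ge0|exact/ltW/student_coef_gt0].
Qed.

(** * Normal laws *)

Section normal.
Context {R : realType}.
Notation mu := (@lebesgue_measure R).

Lemma normal_pdf_neq0E (m s x : R) : s != 0 -> normal_pdf m s x =
  (Num.sqrt (s ^+ 2 * pi *+ 2))^-1 * expR (- (x - m) ^+ 2 / (s ^+ 2 *+ 2)).
Proof. by move=> s0; rewrite normal_pdfE. Qed.

Lemma is_derive_normal_cdf (x : R) :
  is_derive x 1 (@std_normal_cdf R) (normal_pdf 0 1 x).
Proof.
apply: (@derive_cdf R (normal_pdf 0 1)).
  by move=> u; apply: integrableS (integrable_normal_pdf 0 1).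
by apply: continuous_normal_pdf; rewrite oner_eq0.
Qed.

Lemma continuous_normal_cdf : continuous (@std_normal_cdf R).
Proof.
move=> x; have [+ _] := is_derive_normal_cdf x.
by move=> /derivable1_diffP; exact: differentiable_continuous.
Qed.

Lemma normal_cdf_ge0 (x : R) : 0 <= std_normal_cdf x.
Proof. exact/fine_ge0/measure_ge0. Qed.

Lemma normal_probNy (m s y : R) : 0 < s ->
  normal_prob m s `]-oo, y] = (std_normal_cdf ((y - m) / s))%:E.
Proof.
move=> s0.
have -> : (std_normal_cdf ((y - m) / s))%:E = normal_prob 0 1 `]-oo, (y - m) / s].
  rewrite /std_normal_cdf fineK// ge0_fin_numE ?measure_ge0//.
  by apply: (le_lt_trans (probability_le1 _ _)); rewrite ?ltry.
pose F (x : R) := (x - m) / s.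
have dF (x : R) : is_derive x 1 F s^-1.
  rewrite /F (_ : (fun x : R => (x - m) / s) = s^-1 \*: (fun x : R => x - m)); last first.
    by apply/funext => u/=; rewrite /GRing.scale/= mulrC.
  rewrite -[X in is_derive _ _ _ X]mulr1; apply: is_deriveZ.
  rewrite -[X in is_derive _ _ _ X]subr0; exact: is_deriveB.
have F'E : F^`()%classic = cst s^-1.
  by apply/funext => x; rewrite derive1E; apply: derive_val.
have cF : continuous F.
  move=> x; have [+ _] := dF x.
  by move=> /derivable1_diffP; exact: differentiable_continuous.
rewrite /normal_prob -/(F y) (@increasing_ge0_integration_by_substitutionNy R F).
- apply: eq_integral => x _; rewrite fctE /= F'E /=; congr EFin.
  rewrite !normal_pdf_neq0E ?oner_eq0 ?gt_eqF//.
  rewrite /F.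
  have -> : Num.sqrt (s ^+ 2 * pi *+ 2) = s * Num.sqrt (1 ^+ 2 * pi *+ 2).
    rewrite -mulrnAr sqrtrM ?sqr_ge0// sqrtr_sqr gtr0_norm//.
    by rewrite expr1n mul1r.
  rewrite invfM -[RHS]mulrAC; congr (_ * _).
    by rewrite mulrC.
  congr expR; rewrite subr0 expr1n; field.
  by rewrite gt_eqF.
- by move=> u v _ _ uv; rewrite /F ltr_pM2r ?invr_gt0// ltrD2r.
- by rewrite F'E => x _; exact: cst_continuous.
- by rewrite F'E; exact: is_cvg_cst.
- by rewrite F'E; exact: cvg_cst.
- split; first by move=> x _; have [] := dF x.
  exact/cvg_at_left_filter/cF.
- apply: gt0_cvgMlNy; first by rewrite invr_gt0.
  exact: cvg_addrr_Ny.
- apply: continuous_at_within => x _; apply: continuous_normal_pdf.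
  by rewrite oner_eq0.
- by move=> x _; exact: normal_pdf_ge0.
Qed.

(** Completing the square in y: the marginal density of the first variable times the conditional
    normal density of the second, with mean rho x and variance 1 - rho^2. *)
Lemma binormal_pdfE (rho x y : R) : -1 < rho -> rho < 1 ->
  binormal_pdf rho (x, y) =
  normal_pdf 0 1 x * normal_pdf (rho * x) (Num.sqrt (1 - rho ^+ 2)) y.
Proof.
move=> r1 r2.
have r0 : 0 < 1 - rho ^+ 2.
  by rewrite (_ : _ - _ = (1 - rho) * (1 + rho)); [rewrite mulr_gt0; lra|ring].
have s0 : 0 < Num.sqrt (1 - rho ^+ 2) by rewrite sqrtr_gt0.
rewrite !normal_pdf_neq0E ?oner_eq0 ?gt_eqF//.
rewrite /binormal_pdf/= sqr_sqrtr ?(ltW r0)// [RHS]mulrACA; congr (_ * _).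
  have p2 : 0 <= pi *+ 2 :> R by apply: mulrn_wge0; exact: pi_ge0.
  rewrite -invfM; congr (_^-1).
  rewrite expr1n mul1r -mulrnAr sqrtrM ?(ltW r0)//.
  rewrite mulrCA mulrC -expr2 sqr_sqrtr//.
  by rewrite [2 * pi]mulrC mulr_natr.
rewrite -expRD; congr expR; rewrite expr1n subr0.
by field; rewrite gt_eqF.
Qed.

Lemma binormal_pdfC (rho x y : R) : binormal_pdf rho (x, y) = binormal_pdf rho (y, x).
Proof.
rewrite /binormal_pdf/=.
have -> : x ^+ 2 - 2 * rho * x * y + y ^+ 2 = y ^+ 2 - 2 * rho * y * x + x ^+ 2 by ring.
by [].
Qed.

(** The substitution t = x^2, with Jacobian 2x, on densities. It is the source of the a + 1 degrees
    of freedom in Omega: weighting by x^a adds a to the single degree of freedom of a squared normal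
    variable. *)
Lemma chi2_normal_pdf (a x : R) : 0 < a -> 0 < x ->
  chi2_pdf (a + 1) (x ^+ 2) * (2 * x) = x `^ a / tail_coef a * normal_pdf 0 1 x.
Proof.
move=> a0 x0.
have a10 : 0 < (1 + a) / 2 by rewrite divr_gt0// addr_gt0.
have g0 := gamma_fun_gt0 a10.
rewrite chi2_pdf_posE ?exprn_gt0// /chi2_const normal_pdf_neq0E ?oner_eq0//.
rewrite /tail_coef [a + 1]addrC.
set g := gamma_fun _ in g0 *.
have -> : expR (- (x - 0) ^+ 2 / (1 ^+ 2 *+ 2)) = expR (- x ^+ 2 / 2).
  by rewrite subr0 expr1n.
have -> : (x ^+ 2) `^ ((1 + a) / 2 - 1) = x `^ a / x.
  rewrite -(powR_mulrn 2 (ltW x0)) -powRrM.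
  rewrite (_ : 2%:R * ((1 + a) / 2 - 1) = a - 1); last by field.
  by rewrite powRB ?powRr1 ?(ltW x0)// (gt_eqF x0) implybT.
have -> : (2 : R) `^ ((1 + a) / 2) = 2 `^ (a / 2) * Num.sqrt 2.
  rewrite -powR12_sqrt// -powRD; last by rewrite pnatr_eq0 implybT.
  by congr (_ `^ _); rewrite mulrDl mul1r addrC.
have -> : 2 `^ (a / 2 - 1) = 2 `^ (a / 2) / 2 :> R.
  by rewrite powRB ?powRr1// pnatr_eq0 implybT.
have -> : Num.sqrt (1 ^+ 2 * pi *+ 2) = Num.sqrt pi * Num.sqrt 2 :> R.
  by rewrite expr1n mul1r -mulr_natr sqrtrM ?pi_ge0.
have a1 : 0 < (2 : R) `^ (a / 2) by rewrite powR_gt0.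
have a2 : 0 < Num.sqrt 2 :> R by rewrite sqrtr_gt0.
have a3 : 0 < Num.sqrt pi :> R by rewrite sqrtr_gt0 pi_gt0.
by field; rewrite !gt_eqF.
Qed.

Lemma half_normal_chi2 (a : R) (h : R -> R) : 0 < a ->
  (forall x : R, x < 0 -> {for x, continuous h}) ->
  (forall x : R, x < 0 -> 0 <= h x) ->
  (\int[mu]_(x in `]-oo, 0%R[)
     ((- x) `^ a / tail_coef a * normal_pdf 0 1 x * h x)%:E =
   \int[mu]_(t in `]0%R, +oo[)
     (chi2_pdf (a + 1) t * h (- Num.sqrt t)%R)%:E)%E.
Proof.
move=> a0 ch h0.
have a10 : 0 < a + 1 by rewrite addr_gt0.
have c0 := tail_coef_gt0 a0.
rewrite ge0_integration_by_substitution_Nyo; last 2 first.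
- move=> x x0; apply: cvgM; last exact: ch.
  apply: cvgM; last by apply: continuous_normal_pdf; rewrite oner_eq0.
  apply: cvgMl.
  apply: (@continuous_comp _ _ _ (fun x : R => - x) (fun t : R => t `^ a)).
    exact: continuousN.
  by apply: continuous_powR_gt0; rewrite oppr_gt0.
- move=> x x0; apply: mulr_ge0; last exact: h0.
  apply: mulr_ge0; last exact: normal_pdf_ge0.
  by apply: divr_ge0; [exact: powR_ge0|exact: ltW].
have dF (x : R) : 0 < x -> is_derive x 1 (fun x : R => x ^+ 2) (2 * x).
  move=> _; rewrite (_ : 2 * x = (2%:R * id x ^+ 1) *: 1); last first.
    by rewrite /GRing.scale/= expr1 mulr1.
  exact: (@is_deriveX _ _ id 2 x 1 1).
rewrite (@ge0_integration_by_substitution_oy _ _ _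
  (fun t => chi2_pdf (a + 1) t * h (- Num.sqrt t)) dF).
- apply: eq_integral => x; rewrite inE/= in_itv/= andbT => x0; congr EFin.
  rewrite opprK sqrtr_sqr gtr0_norm// [RHS]mulrAC chi2_normal_pdf//.
  congr (_ * _ * _); rewrite !normal_pdf_neq0E ?oner_eq0//.
  by rewrite !subr0 sqrrN.
- by move=> x x0; rewrite mulr_gt0.
- by move=> x x0; apply: cvgM; [exact: cvg_cst|exact: cvg_id].
- by move=> x x0; rewrite exprn_gt0.
- rewrite -[X in _ --> X](expr0n R 2); apply: cvg_at_right_filter.
  exact: exprn_continuous.
- exact: cvgr_expr2.
- move=> x x0; apply: cvgM; first exact: continuous_chi2_pdf.
  apply: (@continuous_comp _ _ _ (fun x : R => - Num.sqrt x) h).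
    by apply: cvgN; exact: sqrt_continuous.
  by apply: ch; rewrite oppr_lt0 sqrtr_gt0.
- move=> x x0; apply: mulr_ge0; first exact: chi2_pdf_ge0.
  by apply: h0; rewrite oppr_lt0 sqrtr_gt0.
Qed.

(** The case [h = 1] of [half_normal_chi2]: a chi-square density has mass 1. *)
Lemma half_normal_moment (a : R) : 0 < a ->
  (\int[mu]_(x in `]-oo, 0%R[)
     ((- x) `^ a / tail_coef a * normal_pdf 0 1 x)%:E = 1)%E.
Proof.
move=> a0; have a10 : 0 < a + 1 by rewrite addr_gt0.
rewrite -[RHS](integral_chi2_pdf_pos a10).
transitivity (\int[mu]_(x in `]-oo, 0%R[)
    ((- x) `^ a / tail_coef a * normal_pdf 0 1 x * (fun=> 1) x)%:E)%E.
  by apply: eq_integral => x _; rewrite mulr1.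
rewrite half_normal_chi2//.
- by apply: eq_integral => x _; rewrite mulr1.
- by move=> x _; exact: cvg_cst.
Qed.

End normal.

(** * The limit integral *)

Section limit_integral.
Context {R : realType}.
Notation mu := (@lebesgue_measure R).
Variable rho : R.
Hypotheses (rho_gtN1 : -1 < rho) (rho_lt1 : rho < 1).

Let sigma := Num.sqrt (1 - rho ^+ 2).
Let sigma0 : 0 < sigma.
Proof.
rewrite sqrtr_gt0 (_ : _ - _ = (1 - rho) * (1 + rho)); last by ring.
by have := rho_gtN1; have := rho_lt1 => h1 h2; apply: mulr_gt0; lra.
Qed.

Lemma binormal_pdf_ge0 z : 0 <= binormal_pdf rho z.
Proof.
apply: mulr_ge0; last exact: expR_ge0.
by rewrite invr_ge0 mulr_ge0 ?sqrtr_ge0// mulr_ge0// pi_ge0.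
Qed.

Lemma measurable_binormal_pdf : measurable_fun setT (binormal_pdf rho).
Proof.
apply: measurable_funM => //; apply: (measurableT_comp (@measurable_expR R)).
apply: measurable_funM => //; apply: measurable_funN.
apply: measurable_funD; last exact: measurable_funX.
apply: measurable_funB; first exact: measurable_funX.
by apply: measurable_funM => //; apply: measurable_funM.
Qed.

(** For [x < 0], the limit of the chi-square tail divided by the level, as found in
    [chi2_tail_cvg]. *)
Definition left_power (a x : R) : R := (- x) `^ a / tail_coef a.

Lemma left_power_ge0 (a x : R) : 0 < a -> 0 <= left_power a x.
Proof. by move=> a0; apply: divr_ge0; [exact: powR_ge0|exact/ltW/tail_coef_gt0]. Qed.

Lemma measurable_left_power (a : R) : measurable_fun setT (left_power a).
Proof.
apply: measurable_funM => //; apply: (measurableT_comp (measurable_powR a)).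
exact: measurable_funN.
Qed.

(** The curve on which the two terms of the minimum coincide ([left_power_cut]): for [x < 0], the
    term in [y] is the larger one to its left. *)
Definition tail_cut (a b x : R) : R := - (Bcoef a b * (- x) `^ (a / b)).

Lemma tail_cut_lt0 (a b x : R) : 0 < a -> 0 < b -> x < 0 -> tail_cut a b x < 0.
Proof.
move=> a0 b0 x0; rewrite oppr_lt0; apply: mulr_gt0.
  rewrite powR_gt0//; apply: divr_gt0; apply: mulr_gt0; rewrite ?powR_gt0//.
    by rewrite gamma_fun_gt0// divr_gt0// addr_gt0.
  by rewrite gamma_fun_gt0// divr_gt0// addr_gt0.
by rewrite powR_gt0// oppr_gt0.
Qed.

(** The factors 1/2 and sqrt pi common to both constants cancel, leaving the ratio in [Bcoef]. *)
Lemma Bcoef_tail (a b : R) : 0 < a -> 0 < b ->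
  Bcoef a b = (tail_coef b / tail_coef a) `^ b^-1.
Proof.
move=> a0 b0; congr (_ `^ _); rewrite /tail_coef.
have a10 : 0 < (1 + a) / 2 by rewrite divr_gt0// addr_gt0.
have b10 : 0 < (1 + b) / 2 by rewrite divr_gt0// addr_gt0.
have ga := gamma_fun_gt0 a10; have gb := gamma_fun_gt0 b10.
move: (gamma_fun _) (gamma_fun _) ga gb => g h ga gb.
have e (c : R) : 2 `^ (c / 2 - 1) = 2 `^ (c / 2) / 2 :> R.
  by rewrite powRB ?powRr1// pnatr_eq0 implybT.
rewrite !e.
have a1 : 0 < (2 : R) `^ (a / 2) by rewrite powR_gt0.
have a2 : 0 < (2 : R) `^ (b / 2) by rewrite powR_gt0.
have a3 : 0 < Num.sqrt pi :> R by rewrite sqrtr_gt0 pi_gt0.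
by field; rewrite !gt_eqF.
Qed.

Lemma left_power_cut (a b x : R) : 0 < a -> 0 < b -> x < 0 ->
  left_power b (tail_cut a b x) = left_power a x.
Proof.
move=> a0 b0 x0; rewrite /left_power /tail_cut opprK (Bcoef_tail a0 b0).
move: (tail_coef a) (tail_coef b) (tail_coef_gt0 a0) (tail_coef_gt0 b0) => A B A0 B0.
have nx0 : 0 <= - x by rewrite oppr_ge0 ltW.
rewrite powRM ?powR_ge0// -!powRrM mulVf ?gt_eqF// divfK ?gt_eqF//.
rewrite powRr1 ?divr_ge0 ?ltW//.
by field; rewrite !gt_eqF.
Qed.

Lemma left_power_le (a x y : R) : 0 < a -> x < 0 -> y < 0 ->
  (left_power a x <= left_power a y) = (y <= x).
Proof.
move=> a0 x0 y0; rewrite ler_pM2r ?invr_gt0 ?tail_coef_gt0//.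
have nx0 : - x \in Num.nneg by rewrite nnegrE oppr_ge0 ltW.
have ny0 : - y \in Num.nneg by rewrite nnegrE oppr_ge0 ltW.
apply/idP/idP => [|yx]; last first.
  by apply: ge0_ler_powR => //; [exact: ltW|rewrite lerN2].
apply: contraTT; rewrite -!ltNge => xy.
by apply: gt0_ltr_powR => //; rewrite ltrN2.
Qed.

(** [left_power a x] equals [left_power b] at the cut, and [left_power b] is decreasing on the
    negative reals; conversely [y < 0] follows since the cut is negative. *)
Lemma le_cutE (a b x y : R) : 0 < a -> 0 < b -> x < 0 ->
  (y < 0) && (left_power a x <= left_power b y) = (y <= tail_cut a b x).
Proof.
move=> a0 b0 x0; have c0 := tail_cut_lt0 a0 b0 x0.
apply/andP/idP => [[y0]|yc].
  by rewrite -(left_power_cut a0 b0 x0) left_power_le.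
have y0 := le_lt_trans yc c0.
by split; [exact: y0|rewrite -(left_power_cut a0 b0 x0) left_power_le].
Qed.

Lemma lt_cutE (a b x y : R) : 0 < a -> 0 < b -> x < 0 ->
  (y < 0) && (left_power a x < left_power b y) = (y < tail_cut a b x).
Proof.
move=> a0 b0 x0; have c0 := tail_cut_lt0 a0 b0 x0.
apply/andP/idP => [[y0]|yc].
  by rewrite -(left_power_cut a0 b0 x0) ltNge left_power_le// -ltNge.
have y0 := lt_trans yc c0.
by split; [exact: y0|rewrite -(left_power_cut a0 b0 x0) ltNge left_power_le// -ltNge].
Qed.

Definition Omega_integrand (a b t : R) : R :=
  std_normal_cdf (- ((Bcoef a b * t `^ (a / (2 * b)) - rho * Num.sqrt t) / sigma)).

Lemma Omega_integrandE (a b t : R) : 0 < a -> 0 < b -> 0 < t ->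
  std_normal_cdf ((tail_cut a b (- Num.sqrt t) - rho * - Num.sqrt t) / sigma) =
  Omega_integrand a b t.
Proof.
move=> a0 b0 t0; rewrite /Omega_integrand /tail_cut; congr std_normal_cdf.
have -> : t `^ (a / (2 * b)) = Num.sqrt t `^ (a / b).
  rewrite -powR12_sqrt ?ltW// -powRrM; congr (_ `^ _).
  by field; rewrite gt_eqF.
by rewrite opprK; ring.
Qed.

(** The normal distribution function is at most 1, so the integral is bounded by the mass of a
    chi-square density. Finiteness is needed because [Omega] is defined as a real number. *)
Lemma Omega_fin (a b : R) : 0 < a ->
  (\int[mu]_(t in `]0%R, +oo[) (chi2_pdf (a + 1) t * Omega_integrand a b t)%:E =
   (Omega rho a b)%:E)%E.
Proof.
move=> a0; have a10 : 0 < a + 1 by rewrite addr_gt0.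
have m : measurable_fun setT (Omega_integrand a b).
  apply: (measurableT_comp (continuous_measurable_fun (@continuous_normal_cdf R))).
  apply: measurable_funN; apply: measurable_funM => //.
  apply: measurable_funB; first exact: measurable_cst_powR.
  apply: measurable_funM => //.
  exact: (continuous_measurable_fun (@sqrt_continuous R)).
rewrite /Omega /Rintegral fineK// ge0_fin_numE; last first.
  apply: integral_ge0 => t _; rewrite lee_fin mulr_ge0 ?chi2_pdf_ge0//.
  exact: normal_cdf_ge0.
apply: (@le_lt_trans _ _ (\int[mu]_(t in `]0%R, +oo[) (chi2_pdf (a + 1) t)%:E)%E).
  apply: ge0_le_integral => //=.
  - move=> t _; rewrite lee_fin mulr_ge0 ?chi2_pdf_ge0//.
    exact: normal_cdf_ge0.
  - apply/measurable_EFinP; apply: measurable_funM.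
      exact: measurable_chi2_pdf.
    exact: measurable_funTS.
  - by apply/measurable_EFinP; exact: measurable_chi2_pdf.
  - move=> t _; rewrite lee_fin ler_piMr ?chi2_pdf_ge0//.
    rewrite -lee_fin /std_normal_cdf fineK; first exact: probability_le1.
    by rewrite ge0_fin_numE ?measure_ge0// (le_lt_trans (probability_le1 _ _))// ltry.
by rewrite integral_chi2_pdf_pos// ltry.
Qed.

(** The inner integral is a conditional normal distribution function at the cut, the outer one goes
    through [half_normal_chi2]. Closed and open half-lines are both allowed, having the same
    integral: the two halves of the minimum treat ties differently. *)
Lemma iterated_Omega (a b : R) (c : R -> R -> bool) : 0 < a -> 0 < b ->
  (forall x, x < 0 -> [set y | c x y] = `]-oo, tail_cut a b x]%classic \/
                      [set y | c x y] = `]-oo, tail_cut a b x[%classic) ->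
  (\int[mu]_x \int[mu]_y
     ((if (x < 0) && c x y then left_power a x else 0) * binormal_pdf rho (x, y))%:E =
   (Omega rho a b)%:E)%E.
Proof.
move=> a0 b0 hc.
pose h x := std_normal_cdf ((tail_cut a b x - rho * x) / sigma).
have inner x : x < 0 -> (\int[mu]_y
    ((if (x < 0) && c x y then left_power a x else 0) * binormal_pdf rho (x, y))%:E =
    (left_power a x * normal_pdf 0 1 x * h x)%:E)%E.
  move=> x0.
  pose k := left_power a x * normal_pdf 0 1 x.
  have k0 : 0 <= k by rewrite mulr_ge0 ?left_power_ge0 ?normal_pdf_ge0.
  pose D := [set y | c x y].
  have mD : measurable D by rewrite /D; case: (hc _ x0) => ->; exact: measurable_itv.
  transitivity (\int[mu]_(y in D) (k%:E * (normal_pdf (rho * x) sigma y)%:E))%E.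
    rewrite [RHS]integral_mkcond; apply: eq_integral => y _.
    rewrite patchE x0/=; case: ifPn => cxy.
      by rewrite mem_set// -EFinM binormal_pdfE// /k mulrA.
    by rewrite memNset ?mul0r//; exact/negP.
  rewrite ge0_integralZl//; last 2 first.
  - apply/measurable_EFinP/measurable_funTS; exact: measurable_normal_pdf.
  - by move=> y _; rewrite lee_fin normal_pdf_ge0.
  rewrite [RHS]EFinM; congr (_ * _)%E.
  rewrite /h -normal_probNy// /normal_prob.
  case: (hc _ x0) => e; rewrite /D e//.
  rewrite integral_itv_bndo_bndc//.
  apply/measurable_EFinP/measurable_funTS; exact: measurable_normal_pdf.
transitivity (\int[mu]_(x in `]-oo, 0%R[)
    (left_power a x * normal_pdf 0 1 x * h x)%:E)%E.
  rewrite [RHS]integral_mkcond; apply: eq_integral => x _.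
  rewrite patchE; case: ifPn; rewrite ?inE ?notin_setE/= in_itv/=.
    exact: inner.
  move=> /negP/negPf x0; under eq_integral do rewrite x0/= mul0r.
  by rewrite integral0.
rewrite half_normal_chi2//.
- apply: etrans (Omega_fin b a0); apply: eq_integral => t; rewrite inE/= in_itv/= andbT => t0.
  by rewrite /h Omega_integrandE.
- move=> x x0; rewrite /h.
  apply: (@continuous_comp _ _ _ (fun x => (tail_cut a b x - rho * x) / sigma)
    (@std_normal_cdf R)); last exact: continuous_normal_cdf.
  apply: cvgMl; apply: cvgB; last first.
    by apply: cvgM; [exact: cvg_cst|exact: cvg_id].
  apply: cvgN; apply: cvgM; first exact: cvg_cst.
  apply: (@continuous_comp _ _ _ (fun x : R => - x) (fun t : R => t `^ (a / b))).
    exact: continuousN.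
  by apply: continuous_powR_gt0; rewrite oppr_gt0.
- by move=> x _; exact: normal_cdf_ge0.
Qed.

Lemma integral_min_left_power (a b : R) : 0 < a -> 0 < b ->
  (\int[mu \x mu]_z
     ((if (z.1 < 0) && (z.2 < 0)
       then Num.min (left_power a z.1) (left_power b z.2) else 0) *
      binormal_pdf rho z)%:E =
   (Omega rho a b + Omega rho b a)%:E)%E.
Proof.
move=> a0 b0.
(* Ties go to [c1] alone, so [f1 + f2] is the minimum times the density at every point. *)
pose c1 x y := (y < 0) && (left_power a x <= left_power b y).
pose c2 y x := (x < 0) && (left_power b y < left_power a x).
pose f1 (z : R * R) :=
  (if (z.1 < 0) && c1 z.1 z.2 then left_power a z.1 else 0) * binormal_pdf rho z.
pose f2 (z : R * R) :=
  (if (z.2 < 0) && c2 z.2 z.1 then left_power b z.2 else 0) * binormal_pdf rho z.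
have mA : measurable_fun setT (fun z : R * R => left_power a z.1).
  exact: (measurableT_comp (measurable_left_power a) measurable_fst).
have mB : measurable_fun setT (fun z : R * R => left_power b z.2).
  exact: (measurableT_comp (measurable_left_power b) measurable_snd).
have m1 : measurable_fun setT (fun z : R * R => z.1 < 0).
  exact: (measurable_fun_ltr measurable_fst).
have m2 : measurable_fun setT (fun z : R * R => z.2 < 0).
  exact: (measurable_fun_ltr measurable_snd).
have mc1 : measurable_fun setT (fun z : R * R => (z.1 < 0) && c1 z.1 z.2).
  exact: (measurable_and m1 (measurable_and m2 (measurable_fun_ler mA mB))).
have mc2 : measurable_fun setT (fun z : R * R => (z.2 < 0) && c2 z.2 z.1).
  exact: (measurable_and m2 (measurable_and m1 (measurable_fun_ltr mB mA))).
have m0 : measurable_fun setT (fun z : R * R => 0 : R) by exact: measurable_cst.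
have mf1 : measurable_fun setT f1.
  apply: measurable_funM; last exact: measurable_binormal_pdf.
  exact: (measurable_fun_ifT mc1 mA m0).
have mf2 : measurable_fun setT f2.
  apply: measurable_funM; last exact: measurable_binormal_pdf.
  exact: (measurable_fun_ifT mc2 mB m0).
have mEf1 : measurable_fun setT (fun z => (f1 z)%:E) by apply/measurable_EFinP; exact: mf1.
have mEf2 : measurable_fun setT (fun z => (f2 z)%:E) by apply/measurable_EFinP; exact: mf2.
have f10 z : 0 <= f1 z.
  apply: mulr_ge0; last exact: binormal_pdf_ge0.
  by case: ifPn => // _; exact: left_power_ge0.
have f20 z : 0 <= f2 z.
  apply: mulr_ge0; last exact: binormal_pdf_ge0.
  by case: ifPn => // _; exact: left_power_ge0.
transitivity (\int[mu \x mu]_z ((f1 z)%:E + (f2 z)%:E))%E.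
  apply: eq_integral => -[x y] _; rewrite -EFinD /f1 /f2 /c1 /c2/= -mulrDl.
  congr (_ * _)%:E.
  case: (ltP x 0) => x0 /=; last by rewrite andbF addr0.
  case: (ltP y 0) => y0 /=; last by rewrite addr0.
  by case: leP => h; rewrite ?addr0 ?add0r.
have e10 z : [set: R * R] z -> (0 <= (f1 z)%:E)%E by rewrite lee_fin => _; exact: f10.
have e20 z : [set: R * R] z -> (0 <= (f2 z)%:E)%E by rewrite lee_fin => _; exact: f20.
transitivity (\int[mu \x mu]_z (f1 z)%:E + \int[mu \x mu]_z (f2 z)%:E)%E.
  exact: (@ge0_integralD _ _ R (mu \x mu)%E setT measurableT _ _ e10 mEf1 e20 mEf2).
rewrite EFinD; congr (_ + _)%E.
- rewrite (@fubini_tonelli1 _ _ _ _ R mu mu _ mEf1 (fun z => e10 z I)).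
  apply: (@iterated_Omega a b c1) => // x x0; left.
  by apply/seteqP; split => y; rewrite /= /c1 le_cutE// in_itv.
(* The other order of integration, with the symmetry of the bivariate density, reduces this half to
   the previous one with [a] and [b] exchanged. *)
- rewrite (@fubini_tonelli2 _ _ _ _ R mu mu _ mEf2 (fun z => e20 z I)).
  have hc2 y : y < 0 -> [set x | c2 y x] = `]-oo, tail_cut b a y]%classic \/
      [set x | c2 y x] = `]-oo, tail_cut b a y[%classic.
    move=> y0; right.
    by apply/seteqP; split => x; rewrite /= /c2 lt_cutE// in_itv.
  apply: etrans (iterated_Omega b0 a0 hc2).
  by apply: eq_integral => y _; apply: eq_integral => x _; rewrite /f2/= binormal_pdfC.
Qed.

(** Integrating the second variable out leaves the half-normal moment. This is the integrability of
    the dominating function. *)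
Lemma integral_left_power (a : R) : 0 < a ->
  (\int[mu \x mu]_z
     ((if z.1 < 0 then left_power a z.1 else 0) * binormal_pdf rho z)%:E = 1)%E.
Proof.
move=> a0.
have mA : measurable_fun setT (fun z : R * R => left_power a z.1).
  exact: (measurableT_comp (measurable_left_power a) measurable_fst).
have m1 : measurable_fun setT (fun z : R * R => z.1 < 0).
  exact: (measurable_fun_ltr measurable_fst).
have m0 : measurable_fun setT (fun z : R * R => 0 : R) by exact: measurable_cst.
rewrite fubini_tonelli1//=; last 2 first.
- apply/measurable_EFinP/measurable_funM; last exact: measurable_binormal_pdf.
  exact: (measurable_fun_ifT m1 mA m0).
- move=> z; rewrite lee_fin; apply: mulr_ge0; last exact: binormal_pdf_ge0.
  by case: ifPn => // _; exact: left_power_ge0.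
rewrite -[RHS](half_normal_moment a0) [RHS]integral_mkcond.
apply: eq_integral => x _; rewrite patchE /fubini_F/= mem_setE in_itv/=.
case: (ltP x 0) => x0; last first.
  by under eq_integral do rewrite mul0r; rewrite integral0.
transitivity (\int[mu]_y ((left_power a x * normal_pdf 0 1 x)%:E *
    (normal_pdf (rho * x) sigma y)%:E))%E.
  by apply: eq_integral => y _; rewrite binormal_pdfE// -EFinM mulrA.
rewrite ge0_integralZl//.
- by rewrite integral_normal_pdf mule1.
- by apply/measurable_EFinP; exact: measurable_normal_pdf.
- by move=> y _; rewrite lee_fin normal_pdf_ge0.
- by rewrite lee_fin mulr_ge0 ?left_power_ge0 ?normal_pdf_ge0.
Qed.

End limit_integral.

(** * The law of (S, Z1, Z2) *)

Section independence.
Local Open Scope ereal_scope.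
Context d d1 d2 (T : measurableType d) (T1 : measurableType d1)
  (T2 : measurableType d2) (R : realType) (P : probability T R).
Variables (X : {RV P >-> T1}) (Y : {RV P >-> T2}).

(** Independence makes the joint law agree with the product measure on rectangles, hence everywhere
    by uniqueness. The product built in the other order, [\x^], is by definition the integral over
    [Y] of the sections in [X]. *)
Lemma independent_law :
  (forall A B, measurable A -> measurable B ->
    P (X @^-1` A `&` Y @^-1` B) = P (X @^-1` A) * P (Y @^-1` B)) ->
  forall E : set (T1 * T2), measurable E ->
  P [set w | E (X w, Y w)] =
  \int[distribution P Y]_y distribution P X (ysection E y).
Proof.
move=> XY E mE.
have mXY : measurable_fun setT (fun w => (X w, Y w)).
  by apply: measurable_fun_pair.
pose XYm : {RV P >-> (T1 * T2)%type} := mfun_Sub (mem_set mXY).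
have e1 : (distribution P X \x distribution P Y) E = distribution P XYm E.
  apply: product_measure_unique => //.
have e2 : (distribution P X \x distribution P Y) E =
    (distribution P X \x^ distribution P Y) E.
  apply: product_measure_unique => // A B mA mB.
  by rewrite /= product_measure2E.
have -> : P [set w | E (X w, Y w)] = distribution P XYm E by [].
by rewrite -e1 e2.
Qed.

End independence.

Lemma uniform_prob_tail {R : realType} (h : R) : 0 <= h <= 1 ->
  uniform_prob (@ltr01 R) `[h, 1[%classic = (1 - h)%:E.
Proof.
move=> /andP[h0 h1]; rewrite /uniform_prob.
transitivity (\int[@lebesgue_measure R]_(x in `[h, 1%R[) (cst 1%:E x))%E.
  apply: eq_integral => x; rewrite inE/= in_itv/= => /andP[hx x1].
  by rewrite /uniform_pdf (le_trans h0 hx) (ltW x1)/= subr0 invr1.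
rewrite integral_cst//= mul1e lebesgue_measure_itv/= lte_fin.
by move: h1; rewrite le_eqVlt => /predU1P[->|->//]; rewrite ltxx subrr.
Qed.

(** Two lower bounds on the same uniform variable amount to the larger one: here the shared S
    creates the minimum. *)
Lemma uniform_prob_min {R : realType} (f1 f2 : R) : 0 < f1 < 1 -> 0 < f2 < 1 ->
  uniform_prob (@ltr01 R) [set s | [&& 0 < s, s < 1, 1 - f1 <= s & 1 - f2 <= s]] =
  (Num.min f1 f2)%:E.
Proof.
move=> /andP[f10 f11] /andP[f20 f21].
have m0 : 0 < Num.min f1 f2 by rewrite lt_min f10.
have m1 : Num.min f1 f2 < 1 by rewrite gt_min f11.
have -> : [set s | [&& 0 < s, s < 1, 1 - f1 <= s & 1 - f2 <= s]] =
    `[1 - Num.min f1 f2, 1[%classic.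
  apply/seteqP; split => s /=; rewrite in_itv/=.
    move=> /and4P[_ -> h1 h2]; rewrite andbT lerBlDr -lerBlDl le_min.
    by rewrite !lerBlDl -!lerBlDr h1 h2.
  move=> /andP[h s1]; rewrite (lt_le_trans _ h) ?subr_gt0// s1/=.
  by rewrite !(le_trans _ h)// lerB// ge_min lexx ?orbT.
rewrite uniform_prob_tail; first by rewrite opprB addrC subrK.
by rewrite subr_ge0 (ltW m1) lerBlDr lerDl ltW.
Qed.

Section copula.
Context {R : realType}.
Notation mu := (@lebesgue_measure R).
Variables (nu1 nu2 rho : R).
Hypotheses (nu1_gt0 : 0 < nu1) (nu2_gt0 : 0 < nu2).
Hypotheses (rho_gtN1 : -1 < rho) (rho_lt1 : rho < 1).
Context (d : measure_display) (T : measurableType d) (P : probability T R).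
Variables (Z1 Z2 S : {RV P >-> R}).
Hypotheses (Z_binormal : is_binormal rho Z1 Z2) (S_uniform : is_uniform01 S)
  (S_indep : independent_of_pair S Z1 Z2).

(** For negative [x] and [z] this is [1 - G nu (x / z)], the probability that the mixing variable is
    at least [x / z]. *)
Definition chi2_tail (nu x z : R) : R := chi2_cdf nu (nu / (x / z) ^+ 2).

Lemma measurable_chi2_tail (nu x : R) : 0 < nu -> measurable_fun setT (chi2_tail nu x).
Proof.
move=> nu0; apply: (measurableT_comp (@measurable_chi2_cdf _ _ nu0 _ measurableT)).
under eq_fun do rewrite expr_div_n invf_div.
apply: measurable_funM => //; apply: measurable_funM => //.
Qed.

Lemma chi2_tail_itv (nu x z : R) : 0 < nu -> x < 0 -> z < 0 ->
  0 < chi2_tail nu x z < 1.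
Proof.
move=> nu0 x0 z0; have y0 : 0 < nu / (x / z) ^+ 2.
  by rewrite divr_gt0// exprn_gt0// nmulr_rgt0// invr_lt0.
by rewrite chi2_cdf_gt0// chi2_cdf_lt1.
Qed.

Lemma Ginv_mul_leE (nu x s z : R) : 0 < nu -> x < 0 ->
  (Ginv nu s * z <= x) = [&& 0 < s < 1, z < 0 & 1 - chi2_tail nu x z <= s].
Proof.
move=> nu0 x0; rewrite Ginv_mul_le//; case: (ltP z 0) => z0; last by rewrite !andbF.
by rewrite /= G_chi2// nmulr_rgt0// invr_lt0.
Qed.

(* The probability that S makes both products at most [x1] and [x2], given
   that (Z1, Z2) = z. *)
Definition joint_tail (x1 x2 : R) (z : R * R) : R :=
  if (z.1 < 0) && (z.2 < 0)
  then Num.min (chi2_tail nu1 x1 z.1) (chi2_tail nu2 x2 z.2) else 0.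

Lemma measurable_joint_tail x1 x2 : measurable_fun setT (joint_tail x1 x2).
Proof.
have m1 : measurable_fun setT (fun z : R * R => z.1 < 0).
  exact: (measurable_fun_ltr measurable_fst).
have m2 : measurable_fun setT (fun z : R * R => z.2 < 0).
  exact: (measurable_fun_ltr measurable_snd).
have mA : measurable_fun setT (fun z : R * R => chi2_tail nu1 x1 z.1).
  exact: (measurableT_comp (measurable_chi2_tail x1 nu1_gt0) measurable_fst).
have mB : measurable_fun setT (fun z : R * R => chi2_tail nu2 x2 z.2).
  exact: (measurableT_comp (measurable_chi2_tail x2 nu2_gt0) measurable_snd).
have m0 : measurable_fun setT (fun z : R * R => 0 : R) by exact: measurable_cst.
exact: (measurable_fun_ifT (measurable_and m1 m2) (measurable_minr mA mB) m0).
Qed.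

Lemma joint_tail_ge0 x1 x2 z : 0 <= joint_tail x1 x2 z.
Proof.
rewrite /joint_tail; case: ifPn => // _.
by rewrite le_min; apply/andP; split; exact: chi2_cdf_ge0.
Qed.

(** Condition on (Z1, Z2): the section of the event at z is a set of values of S, of uniform
    probability [joint_tail x1 x2 z]. *)
Lemma prob_event x1 x2 : x1 < 0 -> x2 < 0 ->
  P [set w | Ginv nu1 (S w) * Z1 w <= x1 /\ Ginv nu2 (S w) * Z2 w <= x2] =
  (\int[mu \x mu]_z (joint_tail x1 x2 z * binormal_pdf rho z)%:E)%E.
Proof.
move=> x10 x20.
have mZ : measurable_fun setT (fun w => (Z1 w, Z2 w)) by exact: measurable_fun_pair.
(* Fixes the product measurable structure on the plane, so that (Z1, Z2) can be packaged as one
   random variable. *)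
pose RR : measurableType _ := (measurableTypeR R * measurableTypeR R)%type.
have mZ' : @measurable_fun _ _ T RR setT (fun w => (Z1 w, Z2 w)) by exact: mZ.
pose Z : {RV P >-> RR} := @mfun_Sub _ _ T RR _ (mem_set mZ').
pose E := [set p : R * (R * R) |
  [&& 0 < p.1, p.1 < 1, p.2.1 < 0, p.2.2 < 0, 1 - chi2_tail nu1 x1 p.2.1 <= p.1
    & 1 - chi2_tail nu2 x2 p.2.2 <= p.1]].
have mE : measurable E.
  have mp1 : measurable_fun setT (fun p : R * (R * R) => p.1) by exact: measurable_fst.
  have mp2 : measurable_fun setT (fun p : R * (R * R) => p.2) by exact: measurable_snd.
  have mp21 := measurableT_comp measurable_fst mp2.
  have mp22 := measurableT_comp measurable_snd mp2.
  have mF1 := measurableT_comp (measurable_chi2_tail x1 nu1_gt0) mp21.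
  have mF2 := measurableT_comp (measurable_chi2_tail x2 nu2_gt0) mp22.
  have m0 : measurable_fun setT (fun p : R * (R * R) => 0 : R) by exact: measurable_cst.
  have m1 : measurable_fun setT (fun p : R * (R * R) => 1 : R) by exact: measurable_cst.
  have mb := measurable_and (measurable_fun_ltr m0 mp1)
    (measurable_and (measurable_fun_ltr mp1 m1)
    (measurable_and (measurable_fun_ltr mp21 m0)
    (measurable_and (measurable_fun_ltr mp22 m0)
    (measurable_and (measurable_fun_ler (measurable_funB m1 mF1) mp1)
                    (measurable_fun_ler (measurable_funB m1 mF2) mp1))))).
  have := mb measurableT [set true] I; rewrite setTI; exact.
have -> : [set w | Ginv nu1 (S w) * Z1 w <= x1 /\ Ginv nu2 (S w) * Z2 w <= x2] =
    [set w | E (S w, Z w)].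
  have andb6 (b1 b2 b3 b4 b5 b6 : bool) :
      [&& b1 && b2, b3 & b5] /\ [&& b1 && b2, b4 & b6] <->
      [&& b1, b2, b3, b4, b5 & b6].
    split=> [[/and3P[/andP[-> ->] -> ->] /and3P[_ -> ->]]//|].
    by move=> /and5P[-> -> -> -> /andP[-> ->]].
  apply/seteqP; split => w;
    rewrite /E/= (Ginv_mul_leE _ _ nu1_gt0 x10) (Ginv_mul_leE _ _ nu2_gt0 x20).
    exact: (andb6 _ _ _ _ _ _).1.
  exact: (andb6 _ _ _ _ _ _).2.
have mE' : measurable (E : set (R * RR)) by exact: mE.
rewrite (@independent_law _ _ _ _ _ _ _ P S Z _ _ mE'); last first.
  by move=> A B mA mB; apply: S_indep.
rewrite (@ge0_integral_density _ _ R (mu \x mu)%E (distribution P Z)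
  (binormal_pdf rho))//; last 3 first.
- exact: measurable_binormal_pdf.
- by move=> z; exact: binormal_pdf_ge0.
- exact: (measurable_fun_ysection (distribution P S) mE).
apply: eq_integral => z _.
suff -> : distribution P S (ysection E z) = (joint_tail x1 x2 z)%:E by [].
have mEz : measurable (ysection E z) by exact: measurable_ysection.
rewrite [LHS](S_uniform mEz) /joint_tail; case: ifPn => [/andP[z10 z20]|z0].
  rewrite -uniform_prob_min; [|exact: chi2_tail_itv|exact: chi2_tail_itv].
  congr uniform_prob; apply/seteqP; split => s; rewrite /ysection/= inE /E/= z10 z20.
    exact: id.
  exact: id.
have -> : ysection E z = set0.
  apply/seteqP; split => s //; rewrite /ysection/= inE /E/=.
  by move=> /and5P[_ _ z10 z20 _]; move: z0; rewrite z10 z20.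
exact: measure0.
Qed.

End copula.

(** * Dominated convergence *)

(** Through min (a, b) = (a + b - |a - b|) / 2. *)
Lemma cvg_minr {R : realType} (u v : R^nat) (a b : R) :
  u n @[n --> \oo] --> a -> v n @[n --> \oo] --> b ->
  Num.min (u n) (v n) @[n --> \oo] --> Num.min a b.
Proof.
move=> ua vb; rewrite minr_absE; under eq_fun do rewrite minr_absE.
by apply: cvgMl; apply: cvgB; [exact: cvgD|apply: cvg_norm; exact: cvgB].
Qed.

Section limit.
Context {R : realType}.
Notation mu := (@lebesgue_measure R).
Variables (nu1 nu2 rho : R).
Hypotheses (nu1_gt0 : 0 < nu1) (nu2_gt0 : 0 < nu2).
Hypotheses (rho_gtN1 : -1 < rho) (rho_lt1 : rho < 1).
Variables (q x1 x2 : R^nat).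
Hypotheses (x1_le : forall n, x1 n <= -1) (x2_le : forall n, x2 n <= -1).
Hypotheses (x1q : forall n, student_cdf nu1 (x1 n) = q n)
  (x2q : forall n, student_cdf nu2 (x2 n) = q n).
Hypothesis q_cvg0 : q n @[n --> \oo] --> (0 : R).

Lemma joint_tail_cvg z :
  joint_tail nu1 nu2 (x1 n) (x2 n) z / q n @[n --> \oo] -->
  if (z.1 < 0) && (z.2 < 0)
  then Num.min (left_power nu1 z.1) (left_power nu2 z.2) else 0.
Proof.
have q0 n : 0 < q n by rewrite -x1q student_cdf_gt0.
rewrite /joint_tail; case: ifPn => [/andP[z10 z20]|_]; last first.
  by under eq_fun do rewrite mul0r; exact: cvg_cst.
have -> : (fun n => Num.min (chi2_tail nu1 (x1 n) z.1) (chi2_tail nu2 (x2 n) z.2) / q n) =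
    (fun n => Num.min (chi2_tail nu1 (x1 n) z.1 / q n) (chi2_tail nu2 (x2 n) z.2 / q n)).
  by apply/funext => n; rewrite -minr_pMl// invr_ge0 ltW.
apply: cvg_minr.
- exact: (chi2_tail_cvg nu1_gt0 x1_le x1q q_cvg0 z10).
- exact: (chi2_tail_cvg nu2_gt0 x2_le x2q q_cvg0 z20).
Qed.

(** The minimum is bounded by its first term alone, so the dominating function depends on [z.1] only
    and [integral_left_power] applies. *)
Lemma joint_tail_le : exists2 C, 0 <= C & forall n z,
  joint_tail nu1 nu2 (x1 n) (x2 n) z / q n <=
  C * (if z.1 < 0 then left_power nu1 z.1 else 0).
Proof.
have q0 n : 0 < q n by rewrite -x1q student_cdf_gt0.
have [C C0 hC] := chi2_tail_bound nu1_gt0 x1_le x1q.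
have t0 := tail_coef_gt0 nu1_gt0.
(* The factor [tail_coef nu1] undoes the normalisation inside [left_power]. *)
exists (C * tail_coef nu1); first exact: mulr_ge0 C0 (ltW t0).
move=> n [z1 z2]; rewrite /joint_tail/=.
case: (ltP z1 0) => z10 /=; last by rewrite mul0r mulr0.
have e : C * tail_coef nu1 * left_power nu1 z1 = C * (- z1) `^ nu1.
  by rewrite /left_power -mulrA [tail_coef _ * _]mulrC divfK ?gt_eqF.
rewrite e; case: ifP => _; last first.
  by rewrite mul0r; apply: mulr_ge0 C0 (powR_ge0 _ _).
apply: le_trans (hC n z1 z10).
by apply: ler_wpM2r; [rewrite invr_ge0 ltW|rewrite ge_min; apply/orP; left; exact: lexx].
Qed.

Lemma integral_joint_tail_cvg :
  (\int[mu \x mu]_z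
     (joint_tail nu1 nu2 (x1 n) (x2 n) z / q n * binormal_pdf rho z)%:E)%E
     @[n --> \oo] --> (Omega rho nu1 nu2 + Omega rho nu2 nu1)%:E.
Proof.
have q0 n : 0 < q n by rewrite -x1q student_cdf_gt0.
have [C C0 hC] := joint_tail_le.
pose lp (z : R * R) := if z.1 < 0 then left_power nu1 z.1 else 0.
have mlp : measurable_fun setT lp.
  have m1 : measurable_fun setT (fun z : R * R => z.1 < 0).
    exact: (measurable_fun_ltr measurable_fst).
  have mA : measurable_fun setT (fun z : R * R => left_power nu1 z.1).
    exact: (measurableT_comp (measurable_left_power nu1) measurable_fst).
  have m0 : measurable_fun setT (fun z : R * R => 0 : R) by exact: measurable_cst.
  exact: (measurable_fun_ifT m1 mA m0).
have mg : measurable_fun setT (fun z => (lp z * binormal_pdf rho z)%:E).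
  apply/measurable_EFinP.
  exact: (measurable_funM mlp (measurable_binormal_pdf rho)).
have lp0 z : 0 <= lp z.
  by rewrite /lp; case: ifPn => // _; exact: left_power_ge0.
have g0 z : 0 <= lp z * binormal_pdf rho z.
  exact: mulr_ge0 (lp0 z) (binormal_pdf_ge0 rho z).
have ig : (mu \x mu)%E.-integrable setT (fun z => (lp z * binormal_pdf rho z)%:E).
  apply/integrableP; split; first exact: mg.
  under eq_integral do rewrite gee0_abs ?lee_fin//.
  by rewrite (integral_left_power rho_gtN1 rho_lt1 nu1_gt0) ltry.
rewrite -(integral_min_left_power rho_gtN1 rho_lt1 nu1_gt0 nu2_gt0).
apply: (@dominated_cvg _ _ R (mu \x mu)%E setT measurableT _ _
  (fun z => C%:E * (lp z * binormal_pdf rho z)%:E)%E).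
- move=> n; apply/measurable_EFinP.
  have mj := measurable_joint_tail nu1_gt0 nu2_gt0 (x1 n) (x2 n).
  have mc : measurable_fun setT (fun z : R * R => (q n)^-1) by exact: measurable_cst.
  exact: (measurable_funM (measurable_funM mj mc) (measurable_binormal_pdf rho)).
- move=> z _; apply: cvg_EFin; first by near=> n.
  by apply: cvgMl; exact: joint_tail_cvg.
- by move=> z _.
- exact: integrableZl.
- move=> n z _; rewrite -EFinM lee_fin ger0_norm; last first.
    apply: mulr_ge0; last exact: binormal_pdf_ge0.
    by apply: mulr_ge0; [exact: joint_tail_ge0|rewrite invr_ge0 ltW].
  by rewrite [leRHS]mulrA; apply: ler_wpM2r; [exact: binormal_pdf_ge0|exact: hC].
Unshelve. all: by end_near. Qed.

Context (d : measure_display) (T : measurableType d) (P : probability T R).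
Variables (Z1 Z2 S : {RV P >-> R}).
Hypotheses (Z_binormal : is_binormal rho Z1 Z2) (S_uniform : is_uniform01 S)
  (S_indep : independent_of_pair S Z1 Z2).

Lemma ttilde_copula_cvg :
  ttilde_copula nu1 nu2 S Z1 Z2 (q n) (q n) / q n @[n --> \oo] -->
  Omega rho nu1 nu2 + Omega rho nu2 nu1.
Proof.
have q0 n : 0 < q n by rewrite -x1q student_cdf_gt0.
have [_ fcvg] := (fine_cvgP _ _).1 integral_joint_tail_cvg.
apply: cvg_trans fcvg; apply: near_eq_cvg; near=> n.
apply/esym; rewrite /= /ttilde_copula /ttilde_margin.
have -> : [set w | student_cdf nu1 (Ginv nu1 (S w) * Z1 w) <= q n /\
                   student_cdf nu2 (Ginv nu2 (S w) * Z2 w) <= q n] =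
    [set w | Ginv nu1 (S w) * Z1 w <= x1 n /\ Ginv nu2 (S w) * Z2 w <= x2 n].
  (* The Student distribution function is strictly increasing and [x1 n] is its quantile at level
     [q n]. *)
  have e1 y : (student_cdf nu1 y <= q n) = (y <= x1 n).
    by rewrite -(x1q n) student_cdf_incr.
  have e2 y : (student_cdf nu2 y <= q n) = (y <= x2 n).
    by rewrite -(x2q n) student_cdf_incr.
  apply/funext => w /=; rewrite e1 e2; reflexivity.
have x10 : x1 n < 0 by rewrite (le_lt_trans (x1_le n))// ltrN10.
have x20 : x2 n < 0 by rewrite (le_lt_trans (x2_le n))// ltrN10.
rewrite (prob_event nu1_gt0 nu2_gt0 Z_binormal S_uniform S_indep x10 x20).
have mj : measurable_fun setT
    (fun z => (joint_tail nu1 nu2 (x1 n) (x2 n) z * binormal_pdf rho z)%:E).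
  apply/measurable_EFinP.
  exact: (measurable_funM (measurable_joint_tail nu1_gt0 nu2_gt0 (x1 n) (x2 n))
    (measurable_binormal_pdf rho)).
transitivity (fine ((q n)^-1%:E * \int[mu \x mu]_z
    (joint_tail nu1 nu2 (x1 n) (x2 n) z * binormal_pdf rho z)%:E)%E); last first.
  congr fine; rewrite -(ge0_integralZl (mu \x mu)%E measurableT mj).
  - by apply: eq_integral => z _; rewrite -EFinM mulrA [_^-1 * _]mulrC.
  - move=> z _; rewrite lee_fin.
    by apply: mulr_ge0; [exact: joint_tail_ge0|exact: binormal_pdf_ge0].
  - by rewrite lee_fin invr_ge0 ltW.
have qV0 : 0 < (q n)^-1 by rewrite invr_gt0.
(* For infinite values both sides are 0, [fine] sending the infinities to 0. *)
case: (\int[_]_z _)%E => [r| |]/=; first by rewrite mulrC.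
- by rewrite mul0r gt0_muley.
- by rewrite mul0r gt0_muleNy.
Unshelve. all: by end_near. Qed.

End limit.

Theorem mainTheorem1 (R : realType) (nu1 nu2 rho : R)
    (nu1_gt0 : 0 < nu1) (nu2_gt0 : 0 < nu2)
    (rho_gtN1 : -1 < rho) (rho_lt1 : rho < 1)
    (d : measure_display) (T : measurableType d) (P : probability T R)
    (Z1 Z2 S : {RV P >-> R})
    (Z_binormal : is_binormal rho Z1 Z2)
    (S_uniform : is_uniform01 S)
    (S_indep : independent_of_pair S Z1 Z2) :
  ttilde_copula nu1 nu2 S Z1 Z2 q q / q @[q --> 0^'+] -->
    Omega rho nu1 nu2 + Omega rho nu2 nu1.
Proof.
apply/cvg_at_rightP => u [u_gt0 u_cvg0].
(* Below this level both quantiles exist and are at most -1. *)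
pose m := Num.min (student_cdf nu1 (-1)) (student_cdf nu2 (-1)).
have m0 : 0 < m by rewrite lt_min; apply/andP; split; exact: student_cdf_gt0.
have m1 : m <= student_cdf nu1 (-1) by rewrite ge_min; apply/orP; left; exact: lexx.
have m2 : m <= student_cdf nu2 (-1) by rewrite ge_min; apply/orP; right; exact: lexx.
have [N _ uN] : \forall n \near \oo, u n < m by exact: cvgr_lt u_cvg0 _ m0.
have u_lt n : u (n + N)%N < m by apply: uN; rewrite /= leq_addl.
have quantile nu : 0 < nu -> m <= student_cdf nu (-1) ->
    {x : R^nat | (forall n, x n <= -1) /\
                 (forall n, student_cdf nu (x n) = u (n + N)%N)}.
  move=> nu_gt0 m_le.
  have /choice[x xP] : forall n, exists x, x <= -1 /\ student_cdf nu x = u (n + N)%N.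
    move=> n; have [|x ? ?] := @student_quantile _ _ nu_gt0 (u (n + N)%N).
      by rewrite u_gt0 (lt_le_trans (u_lt n)).
    by exists x.
  by exists x; split => n; have [] := xP n.
have [x1 [x1_le x1E]] := quantile _ nu1_gt0 m1.
have [x2 [x2_le x2E]] := quantile _ nu2_gt0 m2.
(* Dropping the first [N] terms, where the level may exceed [m], leaves the limit unchanged. *)
rewrite -(cvg_shiftn N); apply: (ttilde_copula_cvg nu1_gt0 nu2_gt0 rho_gtN1 rho_lt1
  x1_le x2_le x1E x2E _ Z_binormal S_uniform S_indep).
by rewrite (cvg_shiftn N).
Qed.
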